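(* Let $A$ be the satellite system operator on $X=X_b\times X_c$ given by $$A\begin{bmatrix} x_b \\ x_c \end{bmatrix}=\begin{bmatrix} \mathcal A_b x_b \\ -B_c\mathcal C_b x_b \end{bmatrix},\qquad D(A)=\{(x_b,x_c)\in D(\mathcal A_b)\times X_c:\ \mathcal B_b x_b=C_c x_c\},$$ (with $X_b,X_c,\mathcal A_b,\mathcal B_b,\mathcal C_b,B_c,C_c$ as defined in the context). Then the semigroup $T(t)$ generated by $A$ is exponentially stable, i.e. there exist $M\ge 1$ and $\alpha>0$ such that $\|T(t)\|\le Me^{-\alpha t}$ for all $t\ge 0$.
   Context: Fix constants $\rho,a,E,I,\gamma,m,I_m>0$. Beams: $X_l=L^2([-1,0];\mathbb R^2)$ and $X_r=L^2([0,1];\mathbb R^2)$, each with the norm $\|x\|^2=\int\big((\rho a)^{-1}|x_1|^2+EI|x_2|^2\big)\,d\xi$, where $x=(x_1,x_2)$. Left beam: $D(\mathcal A_l)=\{x\in H^2([-1,0];\mathbb R^2): x_2(-1)=x_2'(-1)=0\}$, $\mathcal A_l x=\big(-\gamma(\rho a)^{-1}x_1-EI\,x_2'',\ (\rho a)^{-1}x_1''\big)$, $\mathcal B_l x=(\rho a)^{-1}(x_1(0),x_1'(0))$, $\mathcal C_l x=(-EI\,x_2'(0),\,EI\,x_2(0))$. Right beam: $D(\mathcal A_r)=\{x\in H^2([0,1];\mathbb R^2): x_2(1)=x_2'(1)=0\}$, $\mathcal A_r x$ is given by the same differential expression, $\mathcal B_r x=(\rho a)^{-1}(x_1(0),x_1'(0))$,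 $\mathcal C_r x=(EI\,x_2'(0),\,-EI\,x_2(0))$. Combined beam system: $X_b=X_l\times X_r$ with the product norm $\|(x_l,x_r)\|^2=\|x_l\|^2+\|x_r\|^2$; $D(\mathcal A_b)=\{(x_l,x_r)\in D(\mathcal A_l)\times D(\mathcal A_r):\mathcal B_lx_l=\mathcal B_rx_r\}$, $\mathcal A_b(x_l,x_r)=(\mathcal A_lx_l,\mathcal A_rx_r)$, $\mathcal B_b(x_l,x_r)=\tfrac12\mathcal B_lx_l+\tfrac12\mathcal B_rx_r$, $\mathcal C_b(x_l,x_r)=\mathcal C_lx_l+\mathcal C_rx_r$. Rigid body: $X_c=\mathbb R^2$ with norm $\|x_c\|^2=m|x_{c1}|^2+I_m|x_{c2}|^2$, $B_c=\mathrm{diag}(1/m,1/I_m)$, $C_c$ the $2\times2$ identity matrix. $X=X_b\times X_c$ carries the norm $\|(x_b,x_c)\|_X^2=\|x_b\|_{X_b}^2+\|x_c\|_{X_c}^2$. The operator $A$ generates a $C_0$-semigroup of contractions on $X$. *)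

(* Defs.v *)
From HB Require Import structures.
From mathcomp Require Import all_boot all_order all_algebra.
From mathcomp Require Import generic_quotient ring_quotient.
From mathcomp Require Import all_classical all_reals all_analysis.

Set Implicit Arguments.
Unset Strict Implicit.
Unset Printing Implicit Defensive.

Import Order.TTheory GRing.Theory Num.Theory.
Import numFieldNormedType.Exports.
Local Open Scope classical_set_scope.
Local Open Scope ring_scope.
Local Open Scope quotient_scope.

Section L2.
Context {R : realType} (a b : R).

Definition itv_measure : {measure set (measurableTypeR R) -> \bar R} :=
  mrestr (@lebesgue_measure R) (measurable_itv `[a, b]).

(* Square-integrable functions. They are defined on all of R, but only their
   restrictions to [a, b] matter, since itv_measure vanishes outside [a, b]. *)
Definition L2fun := LfunType itv_measure (lee1n 2).

HB.instance Definition _ := GRing.Lmodule.on L2fun.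

Definition null_fun : {pred L2fun} :=
  fun f => `[< ae_eq itv_measure setT (f : R -> R) (cst 0) >].

Fact null_fun_zmod_closed : zmod_closed null_fun.
Proof.
split=> [|f g /asboolP f0 /asboolP g0]; apply/asboolP.
  exact/aeW.
apply: filterS2 f0 g0 => x f0 g0 _.
by rewrite -[LHS]/((f : R -> R) x - (g : R -> R) x) (f0 Logic.I) (g0 Logic.I) subrr.
Qed.

HB.instance Definition _ :=
  GRing.isZmodClosed.Build L2fun null_fun null_fun_zmod_closed.

Definition L2 := Quotient.quot null_fun.

HB.instance Definition _ := GRing.Zmodule.on L2.

Fact L2_piD (f g : L2fun) : \pi_L2 (f + g) = \pi_L2 f + \pi_L2 g.
Proof. exact: Quotient.pi_add. Qed.

Definition L2_scale (k : R) (f : L2) : L2 := \pi_L2 (k *: repr f).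

Lemma L2_scale_pi (k : R) (f : L2fun) :
  L2_scale k (\pi_L2 f) = \pi_L2 (k *: f).
Proof.
apply/eqP; rewrite -Quotient.idealrBE -scalerBr.
have : repr (\pi_L2 f) - f \in null_fun by rewrite Quotient.idealrBE reprK.
move=> /asboolP f0; apply/asboolP; apply: filterS f0 => x f0 _.
set g := _ - _ in f0 *.
by rewrite -[LHS]/(k * (g : R -> R) x) (f0 Logic.I) mulr0.
Qed.

Fact L2_scaleA (k l : R) (f : L2) :
  L2_scale k (L2_scale l f) = L2_scale (k * l) f.
Proof. by rewrite [in RHS]/L2_scale -scalerA -L2_scale_pi. Qed.

Fact L2_scale1 : left_id 1 L2_scale.
Proof. by move=> f; rewrite /L2_scale scale1r reprK. Qed.

Fact L2_scaleDr : right_distributive L2_scale +%R.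
Proof.
move=> k f g; rewrite -[f]reprK -[g]reprK -L2_piD !L2_scale_pi scalerDr.
by rewrite L2_piD.
Qed.

Fact L2_scaleDl (f : L2) : {morph L2_scale^~ f : k l / k + l}.
Proof. by move=> k l; rewrite /L2_scale scalerDl L2_piD. Qed.

HB.instance Definition _ := GRing.Zmodule_isLmodule.Build R L2
  L2_scaleA L2_scale1 L2_scaleDr L2_scaleDl.

Definition L2_fun (f : L2) : R -> R := repr f.

End L2.

Coercion L2_fun : L2 >-> Funclass.

Section H2.
Context {R : realType} (a b : R).

(* u is absolutely continuous on [a, b], with almost everywhere derivative v. *)
Definition primitive_on (u v : R -> R) : Prop :=
  (@lebesgue_measure R).-integrable `[a, b] (EFin \o v) /\
  forall x, x \in `[a, b] ->
    u x = u a + \int[@lebesgue_measure R]_(t in `[a, x]) v t.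

(* d = (u, u', u'') where u is the C^1 representative of the class f on [a, b],
   u' is absolutely continuous and u'' is square-integrable. *)
Definition H2_data (f : L2 a b) (d : (R -> R) * (R -> R) * L2 a b) : Prop :=
  [/\ ae_eq (@lebesgue_measure R) `[a, b]%classic (f : R -> R) d.1.1,
      primitive_on d.1.1 d.1.2 &
      primitive_on d.1.2 d.2].

Definition H2 (f : L2 a b) : Prop := exists d, H2_data f d.

(* When H2 f holds, the data are unique: the first two components as functions
   on [a, b], the last one as a class. Otherwise the default is a junk value. *)
Definition H2_get (f : L2 a b) : (R -> R) * (R -> R) * L2 a b :=
  xget (cst 0, cst 0, 0) (H2_data f).
Definition H2_val (f : L2 a b) : R -> R := (H2_get f).1.1.
Definition H2_deriv (f : L2 a b) : R -> R := (H2_get f).1.2.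
Definition H2_deriv2 (f : L2 a b) : L2 a b := (H2_get f).2.

End H2.

Section semigroup.
Context {R : realType} {V : lmodType R} (nrm : V -> R).

Definition opnorm (f : V -> V) : \bar R :=
  ereal_sup [set (nrm (f x))%:E | x in [set x | nrm x <= 1]].

(* The values of T at negative times are irrelevant. *)
Record C0_semigroup (T : R -> V -> V) : Prop := {
  C0_linear : forall t, 0 <= t -> linear (T t);
  C0_bounded : forall t, 0 <= t -> (opnorm (T t) < +oo)%E;
  C0_id : forall x, T 0 x = x;
  C0_add : forall s t x, 0 <= s -> 0 <= t -> T (s + t) x = T s (T t x);
  C0_cvg : forall x, nrm (T t x - x) @[t --> 0^'+] --> (0 : R)
}.

Definition contractive (T : R -> V -> V) : Prop :=
  forall t, 0 <= t -> (opnorm (T t) <= 1)%E.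

(* The infinitesimal generator of T is the operator A with domain D. *)
Definition generates (D : set V) (A : V -> V) (T : R -> V -> V) : Prop :=
  forall x y, (D x /\ y = A x) <->
    nrm (h^-1 *: (T h x - x) - y) @[h --> 0^'+] --> (0 : R).

Definition exponentially_stable (T : R -> V -> V) : Prop :=
  exists M alpha : R, [/\ 1 <= M, 0 < alpha &
    forall t, 0 <= t -> (opnorm (T t) <= (M * expR (- alpha * t))%:E)%E].

End semigroup.

Section satellite.
Context {R : realType}.
Variables (rho a E I gamma m I_m : R).

Definition beam_space (c d : R) := (L2 c d * L2 c d)%type.

Definition beam_norm c d (x : beam_space c d) : R :=
  Num.sqrt (\int[@lebesgue_measure R]_(xi in `[c, d])
    ((rho * a)^-1 * `|x.1 xi| ^+ 2 + E * I * `|x.2 xi| ^+ 2)).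

Definition beam_op c d (x : beam_space c d) : beam_space c d :=
  (- (gamma * (rho * a)^-1) *: x.1 - (E * I) *: H2_deriv2 x.2,
   (rho * a)^-1 *: H2_deriv2 x.1).

Definition col2 (u v : R) : 'cV[R]_2 := \col_(i < 2) (if i == 0 then u else v).

Notation Xl := (beam_space (-1) 0).
Notation Xr := (beam_space 0 1).

Definition Dl : set Xl := [set x | [/\ H2 x.1, H2 x.2,
  H2_val x.2 (-1) = 0 & H2_deriv x.2 (-1) = 0]].
Definition Al : Xl -> Xl := @beam_op (-1) 0.
Definition Bl (x : Xl) : 'cV[R]_2 :=
  (rho * a)^-1 *: col2 (H2_val x.1 0) (H2_deriv x.1 0).
Definition Cl (x : Xl) : 'cV[R]_2 :=
  col2 (- (E * I * H2_deriv x.2 0)) (E * I * H2_val x.2 0).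

Definition Dr : set Xr := [set x | [/\ H2 x.1, H2 x.2,
  H2_val x.2 1 = 0 & H2_deriv x.2 1 = 0]].
Definition Ar : Xr -> Xr := @beam_op 0 1.
Definition Br (x : Xr) : 'cV[R]_2 :=
  (rho * a)^-1 *: col2 (H2_val x.1 0) (H2_deriv x.1 0).
Definition Cr (x : Xr) : 'cV[R]_2 :=
  col2 (E * I * H2_deriv x.2 0) (- (E * I * H2_val x.2 0)).

Definition Xb := (Xl * Xr)%type.

Definition Xb_norm (x : Xb) : R :=
  Num.sqrt (beam_norm x.1 ^+ 2 + beam_norm x.2 ^+ 2).

Definition Db : set Xb := [set x | [/\ Dl x.1, Dr x.2 & Bl x.1 = Br x.2]].
Definition Ab (x : Xb) : Xb := (Al x.1, Ar x.2).
Definition Bb (x : Xb) : 'cV[R]_2 := 2^-1 *: Bl x.1 + 2^-1 *: Br x.2.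
Definition Cb (x : Xb) : 'cV[R]_2 := Cl x.1 + Cr x.2.

Definition Xc_norm (x : 'cV[R]_2) : R :=
  Num.sqrt (m * `|x 0 0| ^+ 2 + I_m * `|x 1 0| ^+ 2).

Definition Bc : 'M[R]_2 := diag_mx (col2 m^-1 I_m^-1)^T.
Definition Cc : 'M[R]_2 := 1%:M.

Definition X := (Xb * 'cV[R]_2)%type.

Definition X_norm (x : X) : R :=
  Num.sqrt (Xb_norm x.1 ^+ 2 + Xc_norm x.2 ^+ 2).

Definition satellite_dom : set X := [set x | Db x.1 /\ Bb x.1 = Cc *m x.2].
Definition satellite_op (x : X) : X := (Ab x.1, - (Bc *m Cb x.1)).

End satellite.

Arguments X : clear implicits.

(* Main.v *)
Require Import Defs.
From HB Require Import structures.
From mathcomp Require Import all_boot all_order all_algebra.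
From mathcomp Require Import generic_quotient ring_quotient.
From mathcomp Require Import all_classical all_reals all_analysis.
From mathcomp Require Import measurable_realfun.
From mathcomp Require Import ring lra.

Set Implicit Arguments.
Unset Strict Implicit.
Unset Printing Implicit Defensive.

Import Order.TTheory GRing.Theory Num.Theory.
Import numFieldNormedType.Exports.
Local Open Scope classical_set_scope.
Local Open Scope ring_scope.

(** Exponential stability is proved with a Lyapunov functional, in the time
    domain. Write [r = 1 / (rho a)] and [k = E I]; [p] is the momentum density
    (first component) and [q] the curvature (second component) of the beams,
    and [c = (c_1, c_2)] the velocity of the rigid body, so that
    [p_t = - gamma r p - k q''], [q_t = r p''] and [c = r (p(0), p'(0))].

    The energy [|x|^2] is dissipated by the friction in the beams only, at the
    rate [2 gamma r^2 int p^2]: all boundary terms cancel against the forces on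
    the body ([dissipation]). The decay of [q] and [c] is recovered by adding
    to a large multiple of the energy three bounded quadratic terms. Let [W q]
    be the double antiderivative of [q] that vanishes to first order at [0]. It
    is the deflection of the beam seen from the body: twice integrating
    [q_t = r p''] gives [(W q)_t = r p - c_1 - c_2 xi]
    ([L2_antideriv2_deriv2]).
    - The virial [int p W q] has the derivative [- k int q^2] up to products
      with a factor [p], because two integrations by parts turn
      [int q'' W q] into [int q^2]; the free ends and the double zero of [W q]
      leave no boundary term ([virial_opl], [virial_opr]).
    - The total linear momentum [m c_1 + int p] only changes by friction, while
      [int W q] has the derivative [r int p - 2 c_1]; so their product yields
      [- 2 m c_1^2] up to products with a factor [p].
    - In the same way the total angular momentum times [int xi W q] yields
      [- (2 / 3) I_m c_2^2].
    Young's inequality absorbs every product with a factor [p] into the friction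
    ([lyapunov_arithmetic], [lyapunov_decay]).

    For a contraction semigroup, a bounded coercive quadratic form that decays
    along the generator decays exponentially along the orbits that start in the
    domain ([lyapunov_domain_decay]). The semigroup commutes with its generator
    and contracts, hence the error of an Euler step of length [h] is [o(h)]
    uniformly along an orbit, and a discrete Gronwall argument suffices. The
    bound extends to the whole space since the domain is dense
    ([satellite_dom_dense]): repeated averaging makes truncated functions
    smooth ([L2_smooth_approximation]).

    All integrations by parts are between functions that are merely absolutely
    continuous; they come from Fubini's theorem ([primitive_on_ibp]). *)

(** * Lyapunov functionals of contraction semigroups *)

Section lyapunov.
Context {R : realType} {V : lmodType R} (nrm : V -> R).
Hypothesis nrm_ge0 : forall x, 0 <= nrm x.
Hypothesis nrmZ : forall k x, nrm (k *: x) = `|k| * nrm x.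
Hypothesis nrmD : forall x y, nrm (x + y) <= nrm x + nrm y.

(** Since [nrm] may be a mere seminorm, the vectors with [nrm x = 0] are treated
    separately: all their multiples lie in the unit ball. *)
Lemma contractive_le (T : R -> V -> V) t x :
  (forall t, 0 <= t -> linear (T t)) -> contractive nrm T ->
  0 <= t -> nrm (T t x) <= nrm x.
Proof.
move=> linT cT t0.
have TZ k y : T t (k *: y) = k *: T t y.
  have T0 : T t 0 = 0.
    have := linT _ t0 (-1) 0 0.
    by rewrite scaler0 addr0 scaleN1r addNr.
  by have := linT _ t0 k y 0; rewrite T0 !addr0.
have ball1 y : nrm y <= 1 -> nrm (T t y) <= 1.
  move=> y1; rewrite -lee_fin; apply: le_trans (cT _ t0).
  by apply: ereal_sup_ubound; exists y.
have [x0|x0] := eqVneq (nrm x) 0.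
  rewrite x0; apply/ler_addgt0Pl => e e0; rewrite addr0.
  have := ball1 (e^-1 *: x); rewrite TZ !nrmZ x0 mulr0 => /(_ ler01).
  by rewrite gtr0_norm ?invr_gt0// mulrC ler_pdivrMr// mul1r.
have xp : 0 < nrm x by rewrite lt_neqAle eq_sym x0 nrm_ge0.
have := ball1 ((nrm x)^-1 *: x); rewrite TZ !nrmZ.
rewrite gtr0_norm ?invr_gt0// mulVf// => /(_ (lexx _)).
by rewrite mulrC ler_pdivrMr// mul1r.
Qed.

Variables (T : R -> V -> V) (D : set V) (A : V -> V).
Hypothesis T_C0 : C0_semigroup nrm T.
Hypothesis T_contr : contractive nrm T.
Hypothesis T_gen : generates nrm D A T.
Hypothesis D_dense : forall x e, 0 < e -> exists y, D y /\ nrm (x - y) < e.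

Variables (B : V -> V -> R) (C c k : R).
Hypothesis BDl : forall h x y z, B (x + h *: y) z = B x z + h * B y z.
Hypothesis BDr : forall h x y z, B z (x + h *: y) = B z x + h * B z y.
Hypothesis C_gt0 : 0 < C.
Hypothesis c_gt0 : 0 < c.
Hypothesis k_gt0 : 0 < k.
Hypothesis B_bounded : forall x y, `|B x y| <= C * nrm x * nrm y.
Hypothesis B_coercive : forall x, c * nrm x ^+ 2 <= B x x.
Hypothesis B_decay : forall x, D x -> B x (A x) + B (A x) x <= - k * nrm x ^+ 2.

Let T_le t x : 0 <= t -> nrm (T t x) <= nrm x.
Proof. by apply: contractive_le => //; exact: C0_linear T_C0. Qed.

Let TP t h x y : 0 <= t -> T t (x + h *: y) = T t x + h *: T t y.
Proof. by move=> t0; rewrite addrC (C0_linear T_C0 t0) addrC. Qed.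

Let TB t x y : 0 <= t -> T t (x - y) = T t x - T t y.
Proof. by move=> t0; rewrite -scaleN1r TP// scaleN1r. Qed.

Let TZ t a x : 0 <= t -> T t (a *: x) = a *: T t x.
Proof.
by move=> t0; have := TP a 0 x t0; rewrite add0r => ->; rewrite -[0](subrr x) TB// subrr add0r.
Qed.

Let orbitC x s t : 0 <= s -> 0 <= t -> T s (T t x) = T t (T s x).
Proof. by move=> s0 t0; rewrite -!(C0_add T_C0)// addrC. Qed.

(** Contractivity carries the convergence of the difference quotients at [x] over
    to [T t x]. *)
Lemma generator_orbit t x : 0 <= t -> D x ->
  D (T t x) /\ T t (A x) = A (T t x).
Proof.
move=> t0 Dx; apply/T_gen.
have /T_gen := conj Dx (erefl (A x)); apply: squeeze_cvgr => //; last exact: cvg_cst.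
near=> h; rewrite nrm_ge0/=.
have h0 : 0 <= h by apply: ltW; near: h; exact: nbhs_right_gt.
rewrite (orbitC _ h0 t0)// -TB// -TZ// -TB//.
exact: T_le.
Unshelve. all: by end_near. Qed.

Let quotient_error x h := nrm (h^-1 *: (T h x - x) - A x).

(** Both errors are taken at the starting point of the orbit, which makes the
    estimates below uniform in time. *)
Let step_error x h := 2 * C * nrm x * quotient_error x h +
  h * (C * (nrm (A x) + quotient_error x h) ^+ 2).

Let step_error_cvg x : D x -> step_error x h @[h --> 0^'+] --> (0 : R).
Proof.
move=> Dx; have /T_gen := conj Dx (erefl (A x)).
rewrite -[X in X @ _ --> _ -> _]/(quotient_error x) => rx.
have cst_cvg (a : R) : a @[h --> (0 : R)^'+] --> a by exact: cvg_cst.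
have id_cvg : (h : R) @[h --> (0 : R)^'+] --> (0 : R).
  exact: (cvg_at_right_filter (f := id) cvg_id).
have ax_cvg : nrm (A x) + quotient_error x h @[h --> 0^'+] --> nrm (A x) + 0.
  exact: (cvgD (cst_cvg _) rx).
rewrite [X in _ --> X](_ : 0 = 2 * C * nrm x * 0
    + 0 * (C * ((nrm (A x) + 0) * (nrm (A x) + 0)))); last by rewrite mulr0 mul0r addr0.
apply: cvgD; first exact: (cvgM (cst_cvg _) rx).
apply: cvgM; first exact: id_cvg.
by apply: cvgM; [exact: cst_cvg|exact: (cvgM ax_cvg ax_cvg)].
Qed.

(** The expansion of the quadratic form along [T h z = z + h y], where [y] differs
    from [A z] by at most the quotient error at [x], for [z] on the orbit of [x]. *)
Lemma lyapunov_step x t h : D x -> 0 <= t -> 0 < h ->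
  B (T (t + h) x) (T (t + h) x) <=
  (1 - h * (k / C)) * B (T t x) (T t x) + h * step_error x h.
Proof.
move=> Dx t0 h0; have h0' := ltW h0.
set z := T t x.
have [Dz Az] := generator_orbit t0 Dx.
rewrite -/z in Dz Az.
set y := h^-1 *: (T h z - z).
have Thz : T h z = z + h *: y.
  by rewrite /y scalerA divff ?gt_eqF// scale1r subrKC.
have rz : nrm (y - A z) <= quotient_error x h.
  rewrite /y -Az /z (orbitC _ h0' t0) -TB// -TZ// -TB//.
  exact: T_le.
have zx : nrm z <= nrm x by exact: T_le.
have Azx : nrm (A z) <= nrm (A x) by rewrite -Az; exact: T_le.
rewrite (C0_add T_C0)// -(orbitC _ h0' t0) -/z Thz BDl !BDr.
set w := y - A z in rz.
have yE : y = A z + 1 *: w by rewrite scale1r /w subrKC.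
have ny : nrm y <= nrm (A x) + quotient_error x h.
  rewrite yE; apply: (le_trans (nrmD _ _)); rewrite scale1r; exact: lerD.
have Byy : B y y <= C * (nrm (A x) + quotient_error x h) ^+ 2.
  apply: (le_trans (ler_norm _)); apply: (le_trans (B_bounded _ _)).
  by rewrite -mulrA ler_pM2l// expr2 ler_pM.
have Bzz : B z z <= C * nrm z ^+ 2.
  apply: (le_trans (ler_norm _)); apply: (le_trans (B_bounded _ _)).
  by rewrite -mulrA.
have Bzw : B z w <= C * nrm x * quotient_error x h.
  apply: (le_trans (ler_norm _)); apply: (le_trans (B_bounded _ _)).
  by rewrite -!mulrA ler_pM2l// ler_pM.
have Bwz : B w z <= C * nrm x * quotient_error x h.
  apply: (le_trans (ler_norm _)); apply: (le_trans (B_bounded _ _)).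
  by rewrite -!mulrA ler_pM2l// mulrC ler_pM.
have Bd := B_decay Dz.
have Bsum : B z y + B y z <= - (k / C) * B z z + 2 * C * nrm x * quotient_error x h.
  rewrite yE BDl BDr !mul1r.
  have : (k / C) * B z z <= k * nrm z ^+ 2.
    by rewrite mulrAC ler_pdivrMr// -mulrA ler_pM2l// mulrC.
  lra.
have : h * (B z y + B y z) + h * (h * B y y) <=
   h * (- (k / C) * B z z + 2 * C * nrm x * quotient_error x h)
   + h * (h * (C * (nrm (A x) + quotient_error x h) ^+ 2)).
  by rewrite lerD// ler_pM2l// ler_pM2l.
by rewrite /step_error; lra.
Qed.

Lemma lyapunov_iter x h n : D x -> 0 < h -> h * (k / C) <= 1 ->
  B (T (h *+ n) x) (T (h *+ n) x) <=
  (1 - h * (k / C)) ^+ n * B x x + (h *+ n) * step_error x h.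
Proof.
move=> Dx h0 h1.
have d0 : 0 <= step_error x h.
  by rewrite addr_ge0// ?mulr_ge0 ?exprn_ge0 ?addr_ge0 ?nrm_ge0// ltW.
elim: n => [|n IH]; first by rewrite !mulr0n (C0_id T_C0) expr0 mul1r mul0r addr0.
rewrite mulrSr; apply: (le_trans (lyapunov_step Dx _ h0)); first by rewrite mulrn_wge0// ltW.
rewrite [(_ + h) * _]mulrDl addrA lerD2r.
apply: le_trans (ler_wpM2l _ IH) _; first by rewrite subr_ge0.
rewrite mulrDr mulrA -exprS lerD2l; apply: ler_piMl.
  by rewrite mulr_ge0 ?mulrn_wge0// ltW.
by rewrite gerBl mulr_ge0 ?divr_ge0// ltW.
Qed.

(** Take [n] steps of length [t / n]: the factors multiply to at most
    [exp (- (k / C) t)], and the accumulated errors tend to [0]. *)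
Lemma lyapunov_domain_decay x t : D x -> 0 <= t ->
  B (T t x) (T t x) <= expR (- (k / C) * t) * B x x.
Proof.
move=> Dx; rewrite le_eqVlt => /predU1P[<-|t0].
  by rewrite (C0_id T_C0) mulr0 expR0 mul1r.
apply/ler_addgt0Pr => e e0.
have et : 0 < e / t by rewrite divr_gt0.
have [d /= d0 dP] : exists2 d, 0 < d & forall h, 0 < h < d -> step_error x h < e / t.
  have /cvgrPdist_lt /(_ _ et) := step_error_cvg Dx.
  case=> d /= d0 dP; exists d => // h /andP[h0 hd].
  have := dP h; rewrite /ball_/= !sub0r !normrN => /(_ _ h0).
  rewrite [`|h|]gtr0_norm// => /(_ hd); exact: le_lt_trans (ler_norm _).
pose a := k / C.
have a0 : 0 < a by rewrite divr_gt0.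
(* Steps shorter than [d] have a small error, and those shorter than [1 / a] a
   nonnegative factor [1 - h a]. *)
pose n := (Num.truncn (t / d + t * a)).+1.
have nP : t / d + t * a < n%:R by exact: truncnS_gt.
have n0 : 0 < n%:R :> R by rewrite ltr0n.
have td0 : 0 < t / d by rewrite divr_gt0.
have ta0 : 0 < t * a by rewrite mulr_gt0.
pose h := t / n%:R.
have h0 : 0 < h by rewrite divr_gt0.
have hd : h < d.
  by rewrite ltr_pdivrMr// mulrC -ltr_pdivrMr//; apply: le_lt_trans nP; rewrite lerDl ltW.
have ha : h * a <= 1.
  by rewrite /h mulrAC ler_pdivrMr// mul1r ltW//; apply: le_lt_trans nP; rewrite lerDr ltW.
have hn : h *+ n = t by rewrite -mulr_natr /h divfK// gt_eqF.
have := lyapunov_iter n Dx h0 ha; rewrite hn => /le_trans; apply.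
have B0 : 0 <= B x x by apply: le_trans (B_coercive x); rewrite mulr_ge0 ?sqr_ge0// ltW.
apply: lerD; last first.
  by rewrite mulrC -ler_pdivlMr// ltW// dP// h0 hd.
rewrite ler_wpM2r// -/a.
have -> : expR (- a * t) = expR (- (h * a)) ^+ n.
  by rewrite -expRM_natl -hn -mulr_natl; congr expR; ring.
rewrite lerXn2r ?nnegrE ?expR_ge0 ?subr_ge0//.
by apply: le_trans (expR_ge1Dx _).
Qed.

Theorem lyapunov_exponential_stability : exponentially_stable nrm T.
Proof.
(* The form and the squared norm are equivalent up to the factor [C / c], whose
   square root is at most [1 + C / c]. *)
exists (1 + C / c), (k / C / 2); split.
- by rewrite lerDl divr_ge0// ltW.
- by rewrite !divr_gt0.
move=> t t0.
set M := 1 + C / c; set q := expR _.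
have q0 : 0 < q by exact: expR_gt0.
have M0 : 0 < M by rewrite addr_gt0// divr_gt0.
have domP y : D y -> nrm (T t y) <= M * q * nrm y.
  move=> Dy.
  have q0' := ltW q0; have M0' := ltW M0.
  have Mq0 : 0 <= M * q by rewrite mulr_ge0.
  rewrite -(@ler_pXn2r _ 2)// ?nnegrE ?mulr_ge0//.
  have := lyapunov_domain_decay Dy t0.
  move/(le_trans (B_coercive _)).
  have -> : expR (- (k / C) * t) = q ^+ 2.
    by rewrite /q -expRM_natl; congr expR; field; rewrite gt_eqF.
  have ByC : B y y <= C * nrm y ^+ 2.
    by apply: (le_trans (ler_norm _)); rewrite expr2 mulrA; exact: B_bounded.
  move=> H; have {}H : c * nrm (T t y) ^+ 2 <= q ^+ 2 * (C * nrm y ^+ 2).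
    by apply: (le_trans H); rewrite ler_wpM2l ?sqr_ge0.
  rewrite -(ler_pM2l c_gt0); apply: (le_trans H).
  rewrite [leLHS](_ : _ = C * (q ^+ 2 * nrm y ^+ 2)); last by ring.
  rewrite [leRHS](_ : _ = (c * M ^+ 2) * (q ^+ 2 * nrm y ^+ 2)); last by ring.
  rewrite ler_wpM2r ?mulr_ge0 ?sqr_ge0//.
  rewrite /M; have -> : c * (1 + C / c) ^+ 2 = c + 2 * C + C * (C / c).
    by field; rewrite gt_eqF.
  have : 0 <= C * (C / c) by rewrite mulr_ge0 ?divr_ge0// ltW.
  have := C_gt0; have := c_gt0; lra.
apply: ub_ereal_sup => _ [x /= x1 <-]; rewrite lee_fin.
apply/ler_addgt0Pr => e e0.
pose d := e / (1 + M * q).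
have s0 : 0 < 1 + M * q by rewrite addr_gt0 ?mulr_gt0.
have d0 : 0 < d by rewrite divr_gt0.
have [y [Dy yd]] := D_dense x d0.
have -> : T t x = T t y + T t (x - y) by rewrite TB// subrKC.
apply: (le_trans (nrmD _ _)).
have H1 : nrm (T t (x - y)) <= d by apply: le_trans (ltW yd); exact: T_le.
have nyx : nrm y <= 1 + d.
  have -> : y = x + (-1) *: (x - y) by rewrite scaleN1r subKr.
  apply: (le_trans (nrmD _ _)); rewrite nrmZ normrN1 mul1r.
  by apply: lerD => //; exact: ltW.
have H2 : nrm (T t y) <= M * q * (1 + d).
  by apply: (le_trans (domP _ Dy)); rewrite ler_wpM2l// mulr_ge0// ltW.
apply: (le_trans (lerD H2 H1)).
have -> : e = d * (1 + M * q) by rewrite /d divfK// gt_eqF.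
by rewrite le_eqVlt; apply/orP; left; apply/eqP; ring.
Qed.

End lyapunov.

(** * Square-integrable classes *)

Section square_integrable_classes.
Context {R : realType} (a b : R).
Local Notation mu := (@lebesgue_measure R).
Local Notation D := (`[a, b]%classic : set (measurableTypeR R)).
Local Open Scope quotient_scope.

Let itv_measureE A : itv_measure a b A = mu (A `&` D).
Proof. by []. Qed.

Lemma ae_eq_itv_measure (f g : R -> R) :
  ae_eq (itv_measure a b) setT f g <-> ae_eq mu D f g.
Proof.
split=> -[N [mN N0 sN]].
- exists (N `&` D); split => //; first exact: measurableI.
  move=> x /= /not_implyP[Dx fg]; split => //.
  by apply: sN => /= /(_ Logic.I).
- exists (N `|` ~` D); split; first by apply: measurableU => //; exact: measurableC.
    rewrite itv_measureE setIUl setICl setU0.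
    apply/eqP; rewrite -measure_le0 -N0; apply: le_measure; rewrite ?inE//.
    exact: measurableI.
  move=> x /= /not_implyP[_ fg]; have [Dx|] := pselect (D x); last by right.
  by left; apply: sN => /= /(_ Dx).
Qed.

Lemma ge0_integral_itv_measure (f : measurableTypeR R -> \bar R) :
  measurable_fun [set: measurableTypeR R] f -> (forall x, (0 <= f x)%E) ->
  (\int[itv_measure a b]_x f x = \int[mu]_(x in D) f x)%E.
Proof.
move=> mf f0.
rewrite [RHS](eq_measure_integral (itv_measure a b)); last first.
  by move=> A mA AD; rewrite itv_measureE setIidl.
rewrite [LHS](ge0_negligible_integral (N := ~` D))//.
- by rewrite setTD setCK.
- by apply: measurableC.
- by rewrite itv_measureE setICl measure0.
Qed.

Definition square_integrable (u : R -> R) :=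
  measurable_fun D u /\ mu.-integrable D (EFin \o (fun x => u x ^+ 2)).

Lemma L2_measurable (f : L2 a b) : measurable_fun [set: measurableTypeR R] (f : R -> R).
Proof. have := LfunP (repr f); rewrite inE => /andP[+ _]; rewrite inE; exact. Qed.

Lemma L2_square_integrable (f : L2 a b) : square_integrable f.
Proof.
have mf := L2_measurable f.
split; first exact: measurable_funTS.
have := Lfun2_integrable_sqr (LfunP (repr f)).
move=> /integrableP[_]; under eq_integral do rewrite /= -/(L2_fun f).
have mf2 : measurable_fun [set: measurableTypeR R] (EFin \o (fun x => f x ^+ 2)).
  by apply/measurable_EFinP; exact: measurable_funX.
rewrite ge0_integral_itv_measure//; last first.
  apply/measurable_EFinP; apply: measurableT_comp => //.
  exact: measurable_funX.
move=> foo; apply/integrableP; split => //; exact: measurable_funTS.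
Qed.

Lemma L2_pi (f : L2fun a b) : ae_eq mu D (\pi_(L2 a b) f : L2 a b) (f : R -> R).
Proof.
apply/ae_eq_itv_measure.
have : repr (\pi_(L2 a b) f) - f \in @Defs.null_fun R a b.
  by rewrite Quotient.idealrBE reprK.
move=> /asboolP; apply: filterS => x /(_ Logic.I) f0 _.
by apply/eqP; rewrite -subr_eq0; apply/eqP.
Qed.

Lemma L2_exists u : square_integrable u -> exists f : L2 a b, ae_eq mu D f u.
Proof.
move=> [mu_ iu]; pose v := u \_ D.
have mv : measurable_fun [set: measurableTypeR R] v by apply/(measurable_restrictT _ _).1.
have vP : v \in Lfun (itv_measure a b) 2%:E.
  rewrite inE/=; apply/andP; split; rewrite inE//=.
  rewrite /finite_norm unlock poweR_lty//.
  under eq_integral do rewrite /= powR_mulrn// -normrX ger0_norm ?sqr_ge0//.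
  rewrite ge0_integral_itv_measure//; last 2 first.
  - by apply/measurable_EFinP; exact: measurable_funX.
  - by move=> x; rewrite lee_fin sqr_ge0.
  move/integrableP : iu => [_]; apply: le_lt_trans.
  rewrite le_eqVlt; apply/orP; left; apply/eqP; apply: eq_integral => x Dx/=.
  by rewrite ger0_norm ?sqr_ge0// /v patchE Dx.
exists (\pi_(L2 a b) (Lfun_Sub (lee1n 2) vP : L2fun a b)).
apply: ae_eq_trans (L2_pi _) _.
by apply: aeW => x Dx /=; rewrite /v patchE mem_set.
Qed.

Lemma L2_eqP (f g : L2 a b) : ae_eq mu D f g -> f = g.
Proof.
move=> /ae_eq_itv_measure fg; rewrite -[f]reprK -[g]reprK; apply/eqP.
rewrite -Quotient.idealrBE; apply/asboolP; apply: filterS fg => x /(_ Logic.I) fg _.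
by rewrite -[LHS]/(f x - g x) fg subrr.
Qed.

Lemma L2_addE (f g : L2 a b) : ae_eq mu D (f + g : L2 a b) (fun x => f x + g x).
Proof.
have <- : \pi_(L2 a b) (repr f + repr g) = f + g by rewrite L2_piD !reprK.
exact: L2_pi.
Qed.

Lemma L2_scaleE k (f : L2 a b) : ae_eq mu D (k *: f : L2 a b) (fun x => k * f x).
Proof. exact: L2_pi. Qed.

End square_integrable_classes.

(** * Integration by parts for absolutely continuous functions *)

Section integration_by_parts.
Context {R : realType}.
Local Notation mu := (@lebesgue_measure R).

(** Fubini's theorem on the two halves [t <= x] and [x < t] of the plane, for
    the product of [f] and [g]. *)
Lemma integral_lower_upper_triangle (f g : measurableTypeR R -> R) :
  mu.-integrable setT (EFin \o f) -> mu.-integrable setT (EFin \o g) ->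
  (\int[mu]_x (f x * (\int[mu]_(t in `]-oo, x]) g t)%R)%:E +
   \int[mu]_y (g y * (\int[mu]_(t in `]-oo, y[) f t)%R)%:E =
  ((\int[mu]_x f x)%R * (\int[mu]_x g x)%R)%:E)%E.
Proof.
move=> intf intg.
have mf : measurable_fun setT f by apply/measurable_EFinP; exact: measurable_int intf.
have mg : measurable_fun setT g by apply/measurable_EFinP; exact: measurable_int intg.
pose h (z : measurableTypeR R * measurableTypeR R) : \bar R := (f z.1 * g z.2)%:E.
have mh : measurable_fun setT h.
  apply/measurable_EFinP; apply: measurable_funM.
    exact: (measurableT_comp mf measurable_fst).
  exact: (measurableT_comp mg measurable_snd).
have iteratedE x : (\int[mu]_y h (x, y) = (f x)%:E * (\int[mu]_y g y)%R%:E)%E.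
  rewrite /h/=; under eq_integral do rewrite EFinM.
  by rewrite integralZl// /Rintegral fineK//; exact: integrable_fin_num.
have inth : (mu \x mu)%E.-integrable setT h.
  apply/integrable12ltyP => //.
  have ig : (\int[mu]_y `|(g y)%:E| = (\int[mu]_y `|g y|)%R%:E)%E.
    rewrite /Rintegral fineK//.
    by apply: (integrable_fin_num measurableT); exact: integrable_norm.
  rewrite (eq_integral (fun x => `|f x|%:E * (\int[mu]_y `|g y|)%R%:E)%E).
    rewrite integralZr//; last exact: integrable_norm.
    apply: lte_mul_pinfty => //.
    - exact: integral_ge0.
    - by apply: (integrable_fin_num measurableT); exact: integrable_norm.
    - by rewrite ltry.
  move=> x _; rewrite -ig -ge0_integralZl//.
    by apply: eq_integral => y _; rewrite /h/= normrM EFinM.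
  by apply/measurable_EFinP; exact: measurableT_comp.
pose A : set (measurableTypeR R * measurableTypeR R) := [set z | z.2 <= z.1].
have mA : measurable A.
  have md : measurable_fun setT (fun z : measurableTypeR R * measurableTypeR R => z.1 - z.2).
    by apply: measurable_funB; [exact: measurable_fst|exact: measurable_snd].
  have := md measurableT `[0, +oo[%classic (measurable_itv _).
  rewrite setTI; congr (measurable _); apply/seteqP; split => z /=;
    by rewrite /A/= in_itv/= andbT subr_ge0.
have intA : (mu \x mu)%E.-integrable setT (h \_ A).
  apply: (integrable_mkcond _ mA).1.
  exact: (integrableS measurableT mA (@subsetT _ _) inth).
have intAc : (mu \x mu)%E.-integrable setT (h \_ (~` A)).
  apply: (integrable_mkcond _ (measurableC mA)).1.
  exact: (integrableS measurableT (measurableC mA) (@subsetT _ _) inth).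
have integral_h : (\int[mu \x mu]_z h z =
    ((\int[mu]_x f x)%R * (\int[mu]_x g x)%R)%:E)%E.
  rewrite -integral12_prod_meas1// /fubini_F.
  under eq_integral do rewrite iteratedE.
  by rewrite integralZr// /Rintegral EFinM !fineK//; exact: integrable_fin_num.
have integral_A : (\int[mu \x mu]_z (h \_ A) z =
    \int[mu]_x (f x * (\int[mu]_(t in `]-oo, x]) g t)%R)%:E)%E.
  rewrite -integral12_prod_meas1// /fubini_F; apply: eq_integral => x _.
  have -> : (fun y => (h \_ A) (x, y)) = (fun y => (f x)%:E * (g y)%:E)%E \_ `]-oo, x].
    by apply/funext => y; rewrite !patchE /A !mem_setE/= in_itv/=.
  rewrite -integral_mkcond integralZl//; last exact: integrableS intg.
  by rewrite EFinM /Rintegral fineK//; apply: integrable_fin_num => //; exact: integrableS intg.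
have integral_Ac : (\int[mu \x mu]_z (h \_ (~` A)) z =
    \int[mu]_y (g y * (\int[mu]_(t in `]-oo, y[) f t)%R)%:E)%E.
  rewrite -integral21_prod_meas1// /fubini_G; apply: eq_integral => y _.
  have -> : (fun x => (h \_ (~` A)) (x, y)) = (fun x => (g y)%:E * (f x)%:E)%E \_ `]-oo, y[.
    apply/funext => x; rewrite !patchE in_setC /A !mem_setE/= in_itv/= -ltNge.
    by case: ifPn => // _; rewrite /h/= mulrC EFinM.
  rewrite -integral_mkcond integralZl//; last exact: integrableS intf.
  by rewrite EFinM /Rintegral fineK//; apply: integrable_fin_num => //; exact: integrableS intf.
rewrite -integral_A -integral_Ac -integral_h -integralD//.
apply: eq_integral => z _; rewrite !patchE in_setC.
by case: (z \in A); rewrite /= ?adde0 ?add0e.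
Qed.

End integration_by_parts.

Section primitives.
Context {R : realType} (a b : R).
Hypothesis ab : a < b.
Local Notation mu := (@lebesgue_measure R).
Local Notation D := (`[a, b]%classic : set (measurableTypeR R)).
Local Notation V f x := (\int[mu]_(t in `[a, x]) f t).

Let mD : measurable D. Proof. exact: measurable_itv. Qed.

Lemma integrable_sub_itv (f : R -> R) x :
  mu.-integrable D (EFin \o f) -> D x -> mu.-integrable `[a, x] (EFin \o f).
Proof.
rewrite /= in_itv/= => intf /andP[_ xb]; apply: integrableS intf => //.
by apply: subset_itvl; rewrite bnd_simp.
Qed.

Lemma within_continuous_measurable (f : R -> R) :
  {within D, continuous f} -> measurable_fun D f.
Proof. by move=> cf; apply: subspace_continuous_measurable_fun. Qed.

Lemma within_continuous_bounded (f : R -> R) :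
  {within D, continuous f} -> [bounded f x | x in D].
Proof.
move=> cf.
have /compact_bounded[M [_ mrt]] := continuous_compact cf (@segment_compact _ a b).
by exists M; split; rewrite ?num_real // => ? ? ? ?; exact: mrt.
Qed.

Lemma integrable_mul_continuous (f w : R -> R) :
  mu.-integrable D (EFin \o f) -> {within D, continuous w} ->
  mu.-integrable D (EFin \o (fun x => f x * w x)).
Proof.
move=> intf cw; have := integrableMl mD intf (within_continuous_measurable cw).
by move=> /(_ (within_continuous_bounded cw)); apply: eq_integrable.
Qed.

Lemma within_continuous_integrable (f : R -> R) :
  {within D, continuous f} -> mu.-integrable D (EFin \o f).
Proof. by apply: continuous_compact_integrable; exact: segment_compact. Qed.

Lemma within_continuous_square_integrable (f : R -> R) :
  {within D, continuous f} -> square_integrable a b f.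
Proof.
move=> cf; split; first exact: within_continuous_measurable.
rewrite -[X in EFin \o X]/(fun x => f x * f x).
by apply: integrable_mul_continuous => //; exact: within_continuous_integrable.
Qed.

Lemma antiderivative_continuous (f : R -> R) c :
  mu.-integrable D (EFin \o f) -> {within D, continuous (fun x => V f x - c)}.
Proof.
move=> intf x; apply: cvgB; last exact: cvg_cst.
exact: (parameterized_integral_continuous (ltW ab) intf).
Qed.

Lemma eq_within_continuous (f g : R -> R) : {in D, f =1 g} ->
  {within D, continuous f} -> {within D, continuous g}.
Proof.
move=> fg cf; apply: (subspace_eq_continuous _ cf) => x xD.
exact: fg.
Qed.

Lemma primitive_on_continuous (u v : R -> R) :
  primitive_on a b u v -> {within D, continuous u}.
Proof.
move=> [intv uE]; apply: (eq_within_continuous (f := fun x => V v x - (- u a))).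
  by move=> x; rewrite inE => xD; rewrite opprK addrC [RHS]uE.
exact: antiderivative_continuous.
Qed.

(** After the constants [u a] and [v a] are split off, the two products are the
    integrals over the lower and the upper triangle of a square. *)
Lemma primitive_on_ibp (u u1 v v1 : R -> R) :
  primitive_on a b u u1 -> primitive_on a b v v1 ->
  \int[mu]_(x in D) (u1 x * v x + u x * v1 x) = u b * v b - u a * v a.
Proof.
move=> pu pv; have [[iu uE] [iv vE]] := (pu, pv).
have cu := primitive_on_continuous pu; have cv := primitive_on_continuous pv.
have cV : {within D, continuous (fun x => V v1 x)}.
  exact: (parameterized_integral_continuous (ltW ab) iv).
have cU : {within D, continuous (fun x => V u1 x)}.
  exact: (parameterized_integral_continuous (ltW ab) iu).
have tE (f : R -> R) : mu.-integrable D (EFin \o f) ->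
    mu.-integrable setT (EFin \o (f \_ D)).
  by move=> /(integrable_mkcond _ mD).1; rewrite restrict_EFin.
have lower (f : R -> R) x : D x -> \int[mu]_(t in `]-oo, x]) (f \_ D) t = V f x.
  rewrite /= in_itv/= => /andP[ax xb]; rewrite -Rintegral_mkcondr; congr Rintegral.
  apply/seteqP; split => y /=; rewrite !in_itv/=.
    by move=> [yx /andP[ay yb]]; rewrite ay yx.
  by move=> /andP[ay yx]; rewrite yx ay/= (le_trans yx).
have upper (f : R -> R) x : mu.-integrable D (EFin \o f) -> D x ->
    \int[mu]_(t in `]-oo, x[) (f \_ D) t = V f x.
  move=> intf xD; rewrite -lower// Rintegral_itv_bndo_bndc//.
  exact: integrableS (tE _ intf).
have RE (f : R -> R) : mu.-integrable D (EFin \o f) ->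
    ((\int[mu]_(x in D) f x)%:E = \int[mu]_(x in D) (f x)%:E)%E.
  by move=> intf; rewrite /Rintegral fineK//; exact: integrable_fin_num.
have := @integral_lower_upper_triangle R (u1 \_ D) (v1 \_ D) (tE _ iu) (tE _ iv).
rewrite -!Rintegral_mkcond.
have iuV := integrable_mul_continuous iu cV.
have ivU := integrable_mul_continuous iv cU.
rewrite [X in (X + _)%E](_ : _ = (\int[mu]_(x in D) (u1 x * V v1 x))%:E); last first.
  rewrite (RE _ iuV).
  rewrite [RHS]integral_mkcond; apply: eq_integral => x _; rewrite !patchE.
  case: ifPn => [/set_mem xD|_]; first by rewrite lower.
  exact: (congr1 EFin (mul0r _)).
rewrite [X in (_ + X)%E](_ : _ = (\int[mu]_(x in D) (v1 x * V u1 x))%:E); last first.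
  rewrite (RE _ ivU).
  rewrite [RHS]integral_mkcond; apply: eq_integral => x _; rewrite !patchE.
  case: ifPn => [/set_mem xD|_]; first by rewrite upper.
  exact: (congr1 EFin (mul0r _)).
move=> [UV].
have bD : D b by rewrite /= in_itv/= lexx ltW.
rewrite [LHS](_ : _ = \int[mu]_(x in D) ((v a * u1 x + u a * v1 x) +
   (u1 x * V v1 x + v1 x * V u1 x))); last first.
  apply: eq_Rintegral => x; rewrite inE => xD.
  by rewrite (uE _ xD) (vE _ xD); ring.
have iZ k (f : R -> R) : mu.-integrable D (EFin \o f) ->
    mu.-integrable D (EFin \o (fun x => k * f x)) by exact: integrableZl.
have iD (f g : R -> R) : mu.-integrable D (EFin \o f) -> mu.-integrable D (EFin \o g) ->
    mu.-integrable D (EFin \o (fun x => f x + g x)) by exact: integrableD.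
rewrite !RintegralD ?RintegralZl//; [|exact: iZ|exact: iZ|by apply: iD; exact: iZ|exact: iD].
rewrite UV (uE b bD) (vE b bD); ring.
Qed.

Lemma primitive_on_is_derive (u v : R -> R) :
  continuous v -> (forall x : R, is_derive x (1 : R) u (v x)) -> primitive_on a b u v.
Proof.
move=> cv du; have cu x : {for x, continuous u}.
  by apply: differentiable_continuous; apply/derivable1_diffP.
split; first by apply: within_continuous_integrable; exact: continuous_subspaceT.
move=> x; rewrite in_itv/= => /andP[]; rewrite le_eqVlt => /predU1P[<- _|ax xb].
  by rewrite set_itv1 Rintegral_set1 addr0.
rewrite /Rintegral (continuous_FTC2 (F := u))//=.
- by rewrite subrKC.
- exact: continuous_subspaceT.
- split; last 2 first.
  + by apply: cvg_at_right_filter; exact: cu.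
  + by apply: cvg_at_left_filter; exact: cu.
  by move=> y _; apply: ex_derive.
- by move=> y _; rewrite derive1E; exact: derive_val.
Qed.

End primitives.

(** * Inner product and antiderivatives of classes *)

Section semi_inner_product.
Context {R : realType} {V : lmodType R} (B : V -> V -> R).
Hypothesis BC : forall x y, B x y = B y x.
Hypothesis BDl : forall h x y z, B (x + h *: y) z = B x z + h * B y z.
Hypothesis B_ge0 : forall x, 0 <= B x x.

Lemma form_cauchy_schwarz x y : B x y ^+ 2 <= B x x * B y y.
Proof.
have P h : 0 <= B x x + 2 * h * B x y + h ^+ 2 * B y y.
  have := B_ge0 (x + h *: y).
  by rewrite BDl !(BC _ (x + _)) !BDl (BC y x); congr (_ <= _); ring.
have [y0|yN0] := eqVneq (B y y) 0.
  rewrite y0 mulr0; have [->|xy0] := eqVneq (B x y) 0; first by rewrite expr0n.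
  have := P (- (B x x + 1) / (2 * B x y)).
  rewrite y0 mulr0 addr0 [X in _ + X](_ : _ = - (B x x + 1)); last by field.
  lra.
have yp : 0 < B y y by rewrite lt_neqAle eq_sym yN0 B_ge0.
have := P (- B x y / B y y).
rewrite [X in 0 <= X](_ : _ = (B x x * B y y - B x y ^+ 2) / B y y); last by field.
by rewrite pmulr_lge0 ?invr_gt0// subr_ge0.
Qed.

End semi_inner_product.

Section integrals_on_an_interval.
Context {R : realType} (a b : R).
Local Notation mu := (@lebesgue_measure R).
Local Notation D := (`[a, b]%classic : set (measurableTypeR R)).

Lemma ae_eq_itv_refl (f : R -> R) : ae_eq mu D f f.
Proof. exact: aeW. Qed.

Lemma integrable_scale k (f : R -> R) : mu.-integrable D (EFin \o f) ->
  mu.-integrable D (EFin \o (fun x => k * f x)).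
Proof. have mD : measurable D by exact: measurable_itv. exact: (integrableZl mD). Qed.

Lemma integrable_lin k (f g : R -> R) :
  mu.-integrable D (EFin \o f) -> mu.-integrable D (EFin \o g) ->
  mu.-integrable D (EFin \o (fun x => f x + k * g x)).
Proof.
have mD : measurable D by exact: measurable_itv.
by move=> intf /(integrable_scale k); exact: (integrableD mD intf).
Qed.

End integrals_on_an_interval.

Section L2_inner_product.
Context {R : realType} (a b : R).
Hypothesis ab : a < b.
Local Notation mu := (@lebesgue_measure R).
Local Notation D := (`[a, b]%classic : set (measurableTypeR R)).
Local Notation L2 := (L2 a b).
Local Notation sqi := (square_integrable a b).

Let mD : measurable D. Proof. exact: measurable_itv. Qed.

Lemma square_integrable_mul (u v : R -> R) : sqi u -> sqi v ->
  mu.-integrable D (EFin \o (fun x => u x * v x)).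
Proof.
move=> [mu_ iu] [mv iv].
apply: (le_integrable mD _ _ (integrableD mD iu iv)).
  by apply/measurable_EFinP; exact: measurable_funM.
move=> x _ /=; rewrite !lee_fin normrM [leRHS]ger0_norm ?addr_ge0 ?sqr_ge0//.
rewrite -[u x ^+ 2]real_normK ?num_real// -[v x ^+ 2]real_normK ?num_real//.
have := sqr_ge0 (`|u x| - `|v x|); have := sqr_ge0 (`|u x| + `|v x|); lra.
Qed.

Definition dot (f g : L2) : R := \int[mu]_(x in D) (f x * g x).

Lemma dotE (f g : L2) (u v : R -> R) : sqi u -> sqi v ->
  ae_eq mu D f u -> ae_eq mu D g v -> dot f g = \int[mu]_(x in D) (u x * v x).
Proof.
move=> su sv fu gv; congr fine; apply: ae_eq_integral => //.
- exact: measurable_int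
    (square_integrable_mul (L2_square_integrable f) (L2_square_integrable g)).
- exact: measurable_int (square_integrable_mul su sv).
- by apply: filterS2 fu gv => x fu gv Dx; rewrite fu// gv.
Qed.

Let L2i (f g : L2) : mu.-integrable D (EFin \o (fun x => f x * g x)).
Proof. by apply: square_integrable_mul; exact: L2_square_integrable. Qed.

Lemma dotC f g : dot f g = dot g f.
Proof. by apply: eq_Rintegral => x _; rewrite mulrC. Qed.

Lemma square_integrableD (u v : R -> R) k :
  sqi u -> sqi v -> sqi (fun x => u x + k * v x).
Proof.
move=> su sv; have [mu_ iu] := su; have [mv iv] := sv; split.
  by apply: measurable_funD => //; exact: measurable_funM.
have iuv := square_integrable_mul su sv.
have := integrableD mD iu (integrableD mD (integrableZl mD (2 * k) iuv)
  (integrableZl mD (k ^+ 2) iv)).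
by apply: eq_integrable => // x _ /=; rewrite -!EFinM -!EFinD; congr EFin; ring.
Qed.

Lemma L2_linE (f g : L2) k : ae_eq mu D (f + k *: g : L2) (fun x => f x + k * g x).
Proof.
by apply: filterS2 (L2_addE f (k *: g)) (L2_scaleE k g) => x + + Dx => -> // ->.
Qed.

Lemma dot_linl (f g h : L2) k : dot (f + k *: g) h = dot f h + k * dot g h.
Proof.
rewrite (dotE _ _ (L2_linE f g k) (ae_eq_itv_refl a b h)); last 2 first.
- by apply: square_integrableD; exact: L2_square_integrable.
- exact: L2_square_integrable.
rewrite -RintegralZl// -RintegralD//; last exact: integrable_scale.
by apply: eq_Rintegral => x _; ring.
Qed.

Lemma dot_linr (f g h : L2) k : dot h (f + k *: g) = dot h f + k * dot h g.
Proof. by rewrite dotC dot_linl !(dotC h). Qed.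

Lemma dot_ge0 f : 0 <= dot f f.
Proof. by apply: Rintegral_ge0 => x _; rewrite -expr2 sqr_ge0. Qed.

Lemma cauchy_schwarz f g : dot f g ^+ 2 <= dot f f * dot g g.
Proof.
by apply: form_cauchy_schwarz; [exact: dotC|move=> *; exact: dot_linl|exact: dot_ge0].
Qed.

(** The class of a square-integrable function; other functions are sent to a
    junk class, which keeps the operators below total. *)
Definition L2_of (u : R -> R) : L2 := xget 0 [set f : L2 | ae_eq mu D f u].

Lemma L2_ofE u : sqi u -> ae_eq mu D (L2_of u) u.
Proof.
move=> /L2_exists[f fu].
exact: (@xgetPex _ 0 [set f : L2 | ae_eq mu D f u] (ex_intro _ f fu)).
Qed.

Definition L2_one : L2 := L2_of (fun=> 1).
Definition L2_id : L2 := L2_of id.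

Lemma continuous_sqi (u : R -> R) : continuous u -> sqi u.
Proof.
move=> cu; apply: within_continuous_square_integrable.
exact: continuous_subspaceT.
Qed.

Lemma L2_oneE : ae_eq mu D L2_one (fun=> 1).
Proof. by apply: L2_ofE; apply: continuous_sqi => x; exact: cvg_cst. Qed.

Lemma L2_idE : ae_eq mu D L2_id id.
Proof. by apply: L2_ofE; apply: continuous_sqi => x; exact: cvg_id. Qed.

Lemma L2_integrable (f : L2) : mu.-integrable D (EFin \o f).
Proof.
have s1 : sqi (fun=> 1) by apply: continuous_sqi => x; exact: cvg_cst.
have := square_integrable_mul (L2_square_integrable f) s1.
by apply: eq_integrable => // x _ /=; rewrite mulr1.
Qed.

End L2_inner_product.

Section H2_calculus.
Context {R : realType} (a b : R).
Hypothesis ab : a < b.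
Local Notation mu := (@lebesgue_measure R).
Local Notation D := (`[a, b]%classic : set (measurableTypeR R)).
Local Notation L2 := (L2 a b).
Local Notation sqi := (square_integrable a b).
Local Notation V f x := (\int[mu]_(t in `[a, x]) f t).

Let mD : measurable D. Proof. exact: measurable_itv. Qed.

(** Each of the two products is integrated by parts once; the integrals of
    [u1 v1] cancel. *)
Lemma green (f g : L2) u u1 f2 v v1 g2 :
  H2_data f (u, u1, f2) -> H2_data g (v, v1, g2) ->
  dot f g2 - dot g f2 = (u b * v1 b - v b * u1 b) - (u a * v1 a - v a * u1 a).
Proof.
move=> [/= fu pu pu1] [/= gv pv pv1].
have su := within_continuous_square_integrable (primitive_on_continuous ab pu).
have sv := within_continuous_square_integrable (primitive_on_continuous ab pv).
have su1 := within_continuous_square_integrable (primitive_on_continuous ab pu1).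
have sv1 := within_continuous_square_integrable (primitive_on_continuous ab pv1).
have sf2 := L2_square_integrable f2; have sg2 := L2_square_integrable g2.
rewrite (dotE su sg2 fu (ae_eq_itv_refl a b g2)) (dotE sv sf2 gv (ae_eq_itv_refl a b f2)).
have := primitive_on_ibp ab pu pv1; have := primitive_on_ibp ab pv pu1.
rewrite !RintegralD//; try exact: square_integrable_mul.
have -> : \int[mu]_(x in D) (v1 x * u1 x) = \int[mu]_(x in D) (u1 x * v1 x).
  by apply: eq_Rintegral => x _; rewrite mulrC.
lra.
Qed.

Lemma H2_getP (f : L2) : H2 f -> H2_data f (H2_val f, H2_deriv f, H2_deriv2 f).
Proof.
move=> [d fd]; have := xgetPex (cst 0, cst 0, 0) (ex_intro (H2_data f) d fd).
by rewrite /H2_val /H2_deriv /H2_deriv2 /H2_get; case: xget => -[].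
Qed.

Lemma primitive_on_ae (u v w : R -> R) : measurable_fun D w ->
  ae_eq mu D v w -> primitive_on a b u v -> primitive_on a b u w.
Proof.
move=> mw vw [iv uE]; have mv := measurable_int _ iv.
have mEw : measurable_fun D (EFin \o w) by exact/measurable_EFinP.
have vwE : ae_eq mu D (EFin \o v) (EFin \o w).
  by apply: filterS vw => x vw Dx /=; rewrite vw.
split.
  move/integrableP: iv => [_ iv]; apply/integrableP; split => //.
  rewrite (le_lt_trans _ iv)// le_eqVlt; apply/orP; left; apply/eqP.
  apply: ae_eq_integral => //; [exact: measurableT_comp|exact: measurableT_comp|].
  by apply: filterS vw => x vw Dx /=; rewrite vw.
move=> x xD; rewrite uE//; congr (_ + fine _).
have sx : `[a, x] `<=` D.
  by move: xD; rewrite in_itv/= => /andP[ax xb]; apply: subset_itvl; rewrite bnd_simp.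
apply: ae_eq_integral => //.
- exact: measurable_funS mv.
- exact: measurable_funS mEw.
- by apply: ae_eq_subset vwE.
Qed.

Lemma L2_zeroE : ae_eq mu D (0 : L2) (fun=> 0).
Proof.
rewrite -[0 : L2](scale0r (0 : L2)).
by apply: filterS (L2_scaleE 0 (0 : L2)) => x + Dx => ->//; rewrite mul0r.
Qed.

Lemma H2_data_lin (f g : L2) u u1 f2 v v1 g2 k :
  H2_data f (u, u1, f2) -> H2_data g (v, v1, g2) ->
  H2_data (f + k *: g) (fun x => u x + k * v x, fun x => u1 x + k * v1 x, f2 + k *: g2).
Proof.
move=> [/= fu pu pu1] [/= gv pv pv1].
have plin (p q p1 q1 : R -> R) : primitive_on a b p p1 -> primitive_on a b q q1 ->
    primitive_on a b (fun x => p x + k * q x) (fun x => p1 x + k * q1 x).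
  move=> [ip pE] [iq qE]; split.
    exact: integrable_lin.
  move=> x xD; have ipx := integrable_sub_itv ip xD; have iqx := integrable_sub_itv iq xD.
  rewrite RintegralD//; last exact: integrable_scale.
  by rewrite RintegralZl// (pE x)// (qE x)//; ring.
split => /=.
- apply: ae_eq_trans (L2_linE f g k) _.
  by apply: filterS2 fu gv => x fu gv Dx; rewrite fu// gv.
- exact: plin.
- apply: primitive_on_ae (plin _ _ _ _ pu1 pv1).
    by have [] := L2_square_integrable (f2 + k *: g2).
  exact/ae_eq_sym/L2_linE.
Qed.

Let measurable_zero : measurable_fun D (0 : L2).
Proof. by have [] := L2_square_integrable (0 : L2). Qed.

Lemma H2_one : H2_data (L2_one a b) (fun=> 1, fun=> 0, 0).
Proof.
split=> /=; first exact: L2_oneE.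
- apply: primitive_on_is_derive => // x; exact: cvg_cst.
- apply: (primitive_on_ae measurable_zero (ae_eq_sym L2_zeroE)).
  by apply: primitive_on_is_derive => // x; exact: cvg_cst.
Qed.

Lemma H2_id : H2_data (L2_id a b) (id, fun=> 1, 0).
Proof.
split=> /=; first exact: L2_idE.
- by apply: primitive_on_is_derive => // x; exact: cvg_cst.
- apply: (primitive_on_ae measurable_zero (ae_eq_sym L2_zeroE)).
  by apply: primitive_on_is_derive => // x; exact: cvg_cst.
Qed.

Definition antideriv (e : R) (g : R -> R) (x : R) : R := V g x - V g e.

Definition L2_antideriv e (g : L2) : L2 := L2_of a b (antideriv e g).

Variable e : R.
Hypothesis eD : D e.

Lemma antideriv_primitive (g : R -> R) : mu.-integrable D (EFin \o g) ->
  primitive_on a b (antideriv e g) g.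
Proof.
move=> ig; split => // x xD; rewrite /antideriv set_itv1 Rintegral_set1; ring.
Qed.

Lemma antideriv_sqi (g : R -> R) : mu.-integrable D (EFin \o g) ->
  sqi (antideriv e g).
Proof.
move=> /antideriv_primitive/(primitive_on_continuous ab).
exact: within_continuous_square_integrable.
Qed.

Lemma L2_antiderivE (g : L2) : ae_eq mu D (L2_antideriv e g) (antideriv e g).
Proof. by apply/L2_ofE/antideriv_sqi/L2_integrable. Qed.

Lemma ae_antideriv (g h : R -> R) x : D x ->
  mu.-integrable D (EFin \o g) -> mu.-integrable D (EFin \o h) ->
  ae_eq mu D g h -> antideriv e g x = antideriv e h x.
Proof.
move=> xD ig ih gh; rewrite /antideriv.
have VE y : D y -> V g y = V h y.
  move=> yD; congr fine; apply: ae_eq_integral => //.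
  - exact: measurable_int (integrable_sub_itv ig yD).
  - exact: measurable_int (integrable_sub_itv ih yD).
  - apply: (@ae_eq_subset _ _ _ _ _ D).
      by move: yD; rewrite /= in_itv/= => /andP[ax xb]; apply: subset_itvl; rewrite bnd_simp.
    by apply: filterS gh => z gh Dz /=; rewrite gh.
by rewrite !VE.
Qed.

Lemma L2_antideriv_lin (f g : L2) k :
  L2_antideriv e (f + k *: g) = L2_antideriv e f + k *: L2_antideriv e g.
Proof.
apply: L2_eqP; apply: ae_eq_trans (L2_antiderivE _) _; apply: ae_eq_sym.
apply: ae_eq_trans (L2_linE _ _ _) _.
apply: filterS2 (L2_antiderivE f) (L2_antiderivE g) => x fE gE Dx.
rewrite fE// gE//.
have iflin : mu.-integrable D (EFin \o (fun x => f x + k * g x)).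
  by apply: integrable_lin; exact: L2_integrable.
rewrite (ae_antideriv Dx (L2_integrable _) iflin (L2_linE _ _ _)).
have VE y : D y -> V (fun x => f x + k * g x) y = V f y + k * V g y.
  move=> yD; have ify := integrable_sub_itv (L2_integrable f) yD.
  have igy := integrable_sub_itv (L2_integrable g) yD.
  by rewrite RintegralD//; [rewrite RintegralZl|exact: integrable_scale].
by rewrite /antideriv !VE//; ring.
Qed.

(** The antiderivative is at most twice [int |g|], to which the Cauchy-Schwarz
    inequality against [1] applies. *)
Lemma L2_antideriv_bounded (g : L2) :
  dot (L2_antideriv e g) (L2_antideriv e g) <= 4 * (b - a) ^+ 2 * dot g g.
Proof.
set A := \int[mu]_(x in D) `|g x|.
have ig := L2_integrable g.
have sqg : sqi (fun x => `|g x|).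
  have [mg g2] := L2_square_integrable g; split; first exact: measurableT_comp.
  by apply: eq_integrable g2 => // x _ /=; rewrite real_normK ?num_real.
pose h := L2_of a b (fun x => `|g x|).
have hE : ae_eq mu D h (fun x => `|g x|) by exact: L2_ofE.
have s1 : sqi (fun=> 1) by apply: continuous_sqi => // x; exact: cvg_cst.
have A0 : 0 <= A by apply: Rintegral_ge0.
have AE : A = dot h (L2_one a b).
  rewrite (dotE sqg s1 hE (L2_oneE a b)); apply: eq_Rintegral => x _; by rewrite mulr1.
have lenD : fine (mu D) = b - a.
  by rewrite lebesgue_measure_itv/= lte_fin ab.
have oneone : dot (L2_one a b) (L2_one a b) = b - a.
  rewrite (dotE s1 s1 (L2_oneE a b) (L2_oneE a b)) Rintegral_cst// lenD; ring.
have hh : dot h h = dot g g.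
  rewrite (dotE sqg sqg hE hE); apply: eq_Rintegral => x _.
  by rewrite -expr2 real_normK ?num_real// expr2.
have A2 : A ^+ 2 <= dot g g * (b - a).
  by rewrite AE; apply: (le_trans (cauchy_schwarz _ _)); rewrite oneone hh.
have VA y : D y -> `|V g y| <= A.
  move=> yD; apply: le_trans (le_normr_Rintegral _ _) _ => //.
    exact: integrable_sub_itv ig yD.
  rewrite Rintegral_mkcond [leRHS]Rintegral_mkcond.
  have sub : `[a, y] `<=` D.
    by move: yD; rewrite /= in_itv/= => /andP[ax xb]; apply: subset_itvl; rewrite bnd_simp.
  have ign := integrable_norm ig.
  apply: le_Rintegral => //.
  - rewrite -restrict_EFin; apply: (integrable_mkcond _ _).1 => //.
    exact: integrableS ign.
  - by rewrite -restrict_EFin; apply: (integrable_mkcond _ _).1.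
  move=> x _; rewrite !patchE; case: ifPn => [/set_mem xy|_].
    by rewrite ifT// inE; exact: sub.
  by case: ifPn => // _; exact: normr_ge0.
have sJ := antideriv_sqi ig.
rewrite (dotE sJ sJ (L2_antiderivE g) (L2_antiderivE g)).
have -> : 4 * (b - a) ^+ 2 * dot g g = (4 * (b - a) * dot g g) * fine (mu D).
  by rewrite lenD; ring.
rewrite -Rintegral_cst//; apply: le_Rintegral => //.
- exact: square_integrable_mul.
- by apply: within_continuous_integrable; apply: continuous_subspaceT => x; exact: cvg_cst.
move=> x Dx; rewrite -expr2.
have : `|antideriv e g x| <= 2 * A.
  apply: (le_trans (ler_normB _ _)).
  by rewrite [leRHS]mulr_natl mulr2n lerD// VA.
rewrite -(@ler_pXn2r _ 2)// ?nnegrE ?mulr_ge0// real_normK ?num_real//.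
move=> /le_trans; apply; rewrite exprMn -natrX.
by rewrite -mulrA ler_pM2l// mulrC.
Qed.

Definition L2_antideriv2 (g : L2) := L2_antideriv e (L2_antideriv e g).

(** The antiderivatives are functions of classes, hence linear on the nose; this
    makes the Lyapunov functional below an honest bilinear form. *)
Lemma L2_antideriv2_lin (f g : L2) k :
  L2_antideriv2 (f + k *: g) = L2_antideriv2 f + k *: L2_antideriv2 g.
Proof. by rewrite /L2_antideriv2 !L2_antideriv_lin. Qed.

Lemma L2_antideriv2_bounded (g : L2) :
  dot (L2_antideriv2 g) (L2_antideriv2 g) <= (4 * (b - a) ^+ 2) ^+ 2 * dot g g.
Proof.
apply: (le_trans (L2_antideriv_bounded _)); rewrite expr2 -[leRHS]mulrA.
by apply: ler_wpM2l; [rewrite mulr_ge0 ?sqr_ge0|exact: L2_antideriv_bounded].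
Qed.

Lemma antideriv_at (g : R -> R) : antideriv e g e = 0.
Proof. by rewrite /antideriv subrr. Qed.

Lemma L2_antideriv2_data (g : L2) : exists u v : R -> R,
  [/\ H2_data (L2_antideriv2 g) (u, v, g), u e = 0 & v e = 0].
Proof.
have ig := L2_integrable g; have ig1 := L2_integrable (L2_antideriv e g).
exists (antideriv e (L2_antideriv e g)), (antideriv e g); split; try exact: antideriv_at.
split => /=; first exact: L2_antiderivE.
  apply: primitive_on_ae (L2_antiderivE g) (antideriv_primitive ig1).
  by have [] := antideriv_sqi ig.
exact: antideriv_primitive.
Qed.

Lemma L2_antideriv_ae (g : L2) (p q : R -> R) : ae_eq mu D g q ->
  primitive_on a b p q -> ae_eq mu D (L2_antideriv e g) (fun x => p x - p e).
Proof.
move=> gq [iq pE]; apply: filterS (L2_antiderivE g) => x + Dx => ->//.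
rewrite (ae_antideriv Dx (L2_integrable g) iq gq) /antideriv (pE x)// (pE e)//.
ring.
Qed.

(** Integrating [f''] twice from [e] gives back [f] up to its first-order
    Taylor polynomial at [e]. *)
Lemma L2_antideriv2_deriv2 (f : L2) u u1 f2 : H2_data f (u, u1, f2) ->
  L2_antideriv2 f2 =
  f + (- (u e - e * u1 e)) *: L2_one a b + (- u1 e) *: L2_id a b.
Proof.
move=> [/= fu pu pu1]; have [iu1 _] := pu.
have J1 := L2_antideriv_ae (ae_eq_itv_refl a b f2) pu1.
have p2 : primitive_on a b (fun x => u x + (- u1 e) * x) (fun x => u1 x - u1 e).
  have du : H2_data (L2_of a b u) (u, u1, f2).
    split => //=; apply: L2_ofE; apply: within_continuous_square_integrable.
    exact: primitive_on_continuous pu.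
  have [_ /= + _] := H2_data_lin (- u1 e) du H2_id.
  by congr primitive_on; apply/funext => x /=; ring.
have J2 := L2_antideriv_ae J1 p2.
apply: L2_eqP; apply: ae_eq_trans J2 _; apply: ae_eq_sym.
apply: ae_eq_trans (L2_linE _ _ _) _.
have g1 : ae_eq mu D (f + (- (u e - e * u1 e)) *: L2_one a b : L2)
    (fun x => u x - (u e - e * u1 e)).
  apply: filterS3 (L2_linE f (L2_one a b) (- (u e - e * u1 e))) fu (L2_oneE a b) => x fE {}fu oneE Dx.
  by rewrite fE// fu// oneE// mulr1.
apply: filterS2 g1 (L2_idE a b) => x g1 idE Dx.
by rewrite g1// idE//; ring.
Qed.

End H2_calculus.

(** * Uniqueness of weak derivatives *)

Section uniqueness.
Context {R : realType} (a b : R).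
Hypothesis ab : a < b.
Local Notation mu := (@lebesgue_measure R).
Local Notation D := (`[a, b]%classic : set (measurableTypeR R)).

Let mD : measurable D. Proof. exact: measurable_itv. Qed.

(** The integral of [w ^ 2] over [[a, x]] lies between [0] and the integral over
    [[a, b]]; being zero in the interior, it has the derivative [0 = w x ^ 2]. *)
Lemma continuous_integral_sqr_eq0 (w : R -> R) : {within D, continuous w} ->
  \int[mu]_(x in D) (w x ^+ 2) = 0 -> forall x, D x -> w x = 0.
Proof.
move=> cw w0; have [_ iw] := within_continuous_square_integrable cw.
pose F x := \int[mu]_(t in `[a, x]) (w t ^+ 2).
have F0 y : y \in `]a, b[ -> F y = 0.
  rewrite in_itv/= => /andP[ay yb]; apply/eqP; rewrite eq_le; apply/andP; split.
    rewrite -w0 /F Rintegral_mkcond [leRHS]Rintegral_mkcond.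
    have sub : `[a, y] `<=` D by apply: subset_itvl; rewrite bnd_simp ltW.
    apply: le_Rintegral => //.
    - rewrite -restrict_EFin; apply: (integrable_mkcond _ _).1 => //.
      exact: integrableS iw.
    - by rewrite -restrict_EFin; apply: (integrable_mkcond _ _).1.
    move=> x _; rewrite !patchE; case: ifPn => [/set_mem xy|_].
      by rewrite ifT// inE; exact: sub.
    by case: ifPn => // _; exact: sqr_ge0.
  by apply: Rintegral_ge0 => x _; exact: sqr_ge0.
have inner x : x \in `]a, b[ -> w x = 0.
  move=> xab; have /andP[ax xb] : a < x < b by move: xab; rewrite in_itv.
  have [cwi _ _] := (continuous_within_itvP _ ab).1 cw.
  have cw2 : {for x, continuous (fun t => w t ^+ 2)}.
    by apply: (@continuous_comp _ _ _ w (fun y => y ^+ 2)); [exact: cwi|exact: exprn_continuous].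
  have [dF F'] := continuous_FTC1_closed xb iw ax cw2.
  have : derive1 F x = 0.
    rewrite derive1E (@near_eq_derive _ _ _ F (cst 0))//; first exact: derive_cst.
    by near=> y; rewrite F0//; near: y; exact: near_in_itvoo.
  by rewrite F' => /eqP; rewrite sqrf_eq0 => /eqP.
have [_ wa wb] := (continuous_within_itvP _ ab).1 cw.
move=> x /=; rewrite in_itv/= => /andP[]; rewrite le_eqVlt => /predU1P[<- _|ax].
  apply: (@cvg_unique _ (@Rhausdorff R) (w @ a^'+)) => //.
  apply: cvg_near_cst; near=> y; apply: inner.
  by rewrite in_itv/=; apply/andP; split; near: y; [exact: nbhs_right_gt|exact: nbhs_right_lt].
rewrite le_eqVlt => /predU1P[->|xb]; last by apply: inner; rewrite in_itv/= ax.
apply: (@cvg_unique _ (@Rhausdorff R) (w @ b^'-)) => //.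
apply: cvg_near_cst; near=> y; apply: inner.
by rewrite in_itv/=; apply/andP; split; near: y; [exact: nbhs_left_gt|exact: nbhs_left_lt].
Unshelve. all: by end_near. Qed.

(** The difference [w] of the two representatives vanishes almost everywhere,
    hence everywhere by continuity. Then so does its derivative [w1]: integrating
    [w1 ^ 2 + w w''] gives a boundary term that contains [w]. *)
Lemma H2_data_unique (f : L2 a b) u u1 f2 v v1 g2 :
  H2_data f (u, u1, f2) -> H2_data f (v, v1, g2) ->
  forall x, D x -> u x = v x /\ u1 x = v1 x.
Proof.
move=> fu fv; have := H2_data_lin (-1) fu fv.
rewrite scaleN1r subrr => -[/= w0 pw pw1].
set w := (fun x => u x + -1 * v x) in w0 pw; set w1 := (fun x => u1 x + -1 * v1 x) in pw pw1.
have cw := primitive_on_continuous ab pw; have cw1 := primitive_on_continuous ab pw1.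
have {}w0 x : D x -> w x = 0.
  apply: continuous_integral_sqr_eq0 => //.
  have sw := within_continuous_square_integrable cw.
  have -> : \int[mu]_(x in D) (w x ^+ 2) = dot (0 : L2 a b) 0.
    by rewrite (dotE sw sw w0 w0).
  by have := dot_linl (0 : L2 a b) 0 0 (-1); rewrite scaleN1r subrr => ->; ring.
have w1z x : D x -> w1 x = 0.
  apply: continuous_integral_sqr_eq0 => //.
  have := primitive_on_ibp ab pw pw1.
  rewrite !w0 ?bound_itvE/= ?in_itv/= ?lexx ?ltW// !mul0r subrr => <-.
  by apply: eq_Rintegral => y; rewrite inE => Dy; rewrite w0// mul0r addr0 expr2.
move=> x Dx; have := w0 x Dx; have := w1z x Dx; rewrite /w /w1 !mulN1r.
by move=> /subr0_eq -> /subr0_eq ->.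
Qed.

(** Boundary values of a class can be read off any of its representations. *)
Lemma H2_val_derivE (f : L2 a b) u u1 f2 : H2_data f (u, u1, f2) ->
  forall x, D x -> H2_val f x = u x /\ H2_deriv f x = u1 x.
Proof.
move=> fu; have Hf : H2 f by exists (u, u1, f2).
exact: H2_data_unique (H2_getP Hf) fu.
Qed.

End uniqueness.

(** * Density of twice differentiable functions *)

Section dominated.
Context {R : realType} (a b : R).
Local Notation mu := (@lebesgue_measure R).
Local Notation D := (`[a, b]%classic : set (measurableTypeR R)).

Let mD : measurable D. Proof. exact: measurable_itv. Qed.

Lemma dominated_small (w : nat -> R -> R) (g : R -> R) eps :
  (forall n, measurable_fun D (w n)) ->
  {ae mu, forall x, D x -> w n x @[n --> \oo] --> (0 : R)} ->
  mu.-integrable D (EFin \o g) ->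
  (forall n x, D x -> 0 <= w n x <= g x) -> 0 < eps ->
  \forall n \near \oo, \int[mu]_(x in D) w n x < eps.
Proof.
move=> mw cw ig wg e0.
have cwE : {ae mu, forall x, D x -> (w n x)%:E @[n --> \oo] --> 0%E}.
  by apply: filterS cw => x cw Dx; apply: cvg_EFin; [exact: nearW|exact: cw].
have wgE : {ae mu, forall x n, D x -> (`|(w n x)%:E| <= (EFin \o g) x)%E}.
  apply: aeW => x n Dx /=; rewrite lee_fin; have /andP[w0 ?] := wg n x Dx.
  by rewrite ger0_norm.
have mwE n : measurable_fun D (EFin \o w n) by exact/measurable_EFinP.
have [_ _] := dominated_convergence mD mwE (measurable_cst 0%E) cwE ig wgE.
rewrite integral0 => /fine_cvgP[_ /cvgr_lt]; exact.
Qed.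

End dominated.

Section averages.
Context {R : realType}.
Local Notation mu := (@lebesgue_measure R).
Implicit Types (f : R -> R).

Definition bounded_supported (c d K : R) f :=
  [/\ measurable_fun [set: measurableTypeR R] f, forall x, `|f x| <= K &
      forall x, (x < c) || (d < x) -> f x = 0].

Definition primitive f (x : R) : R := \int[mu]_(t in `]-oo, x]) f t.

Definition average h f (x : R) : R := h^-1 * (primitive f (x + h) - primitive f x).

Section fixed.
Variables (c d K : R) (f : R -> R).
Hypothesis fP : bounded_supported c d K f.

Let mf : measurable_fun [set: measurableTypeR R] f. Proof. by case: fP. Qed.
Let fK x : `|f x| <= K. Proof. by case: fP. Qed.
Let f0 x : (x < c) || (d < x) -> f x = 0. Proof. by case: fP => _ _; apply. Qed.
Let K0 : 0 <= K. Proof. by apply: le_trans (fK 0). Qed.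

Lemma bounded_supported_integrable : mu.-integrable [set: measurableTypeR R] (EFin \o f).
Proof.
have mcd : measurable (`[c, d]%classic : set (measurableTypeR R)) by exact: measurable_itv.
have -> : f = f \_ `[c, d].
  apply/funext => x; rewrite patchE; case: ifPn => // /negP xcd; apply: f0.
  apply: contra_notT xcd => /norP[]; rewrite -!leNgt => cx xd.
  by rewrite inE/= in_itv/= cx xd.
rewrite -restrict_EFin; apply: (integrable_mkcond _ mcd).1.
apply: measurable_bounded_integrable => //.
- by apply: compact_finite_measure; exact: segment_compact.
- exact: measurable_funTS.
- by exists K; split; rewrite ?num_real// => M KM x _; apply: le_trans (fK x) (ltW KM).
Qed.

Let intf (A : set (measurableTypeR R)) : measurable A -> mu.-integrable A (EFin \o f).
Proof. by move=> mA; apply: integrableS bounded_supported_integrable. Qed.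

Lemma primitiveB x y : x <= y ->
  primitive f y - primitive f x = \int[mu]_(t in `]x, y]) f t.
Proof. by move=> xy; rewrite /primitive Rintegral_itvB//; exact: intf. Qed.

Lemma primitive_lipschitz x y : x <= y ->
  `|primitive f y - primitive f x| <= K * (y - x).
Proof.
move=> xy; rewrite primitiveB//.
have mxy : measurable (`]x, y]%classic : set (measurableTypeR R)) by exact: measurable_itv.
apply: (le_trans (le_normr_Rintegral mxy (intf mxy))).
have -> : y - x = fine (mu `]x, y]%classic).
  rewrite lebesgue_measure_itv/= lte_fin; case: ltP => // yx.
  by have -> : y = x by [apply/eqP; rewrite eq_le yx xy]; rewrite subrr.
rewrite -Rintegral_cst//; apply: le_Rintegral => //.
- by apply: integrable_norm; exact: intf.
- have mc : measurable (`[x, y]%classic : set (measurableTypeR R)) by exact: measurable_itv.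
  apply: (integrableS mc mxy); first exact: subset_itv_oc_cc.
  by apply: within_continuous_integrable; apply: continuous_subspaceT => t; exact: cvg_cst.
Qed.

Lemma primitive_continuous : continuous (primitive f).
Proof.
move=> x; apply/cvgrPdist_lt => e e0; near=> y.
have le : `|primitive f x - primitive f y| <= K * `|x - y|.
  have [xy|/ltW yx] := leP x y.
    by rewrite distrC [`|x - y|]distrC [`|y - x|]ger0_norm ?subr_ge0// primitive_lipschitz.
  by rewrite [`|x - y|]ger0_norm ?subr_ge0// primitive_lipschitz.
apply: (le_lt_trans le); apply: (@le_lt_trans _ _ ((K + 1) * `|x - y|)).
  by rewrite ler_wpM2r// lerDl.
rewrite mulrC -ltr_pdivlMr ?ltr_wpDl//.
by near: y; apply: (@cvgr_dist_lt _ _ _ _ _ id); [exact: cvg_id|rewrite divr_gt0 ?ltr_wpDl].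
Unshelve. all: by end_near. Qed.

Variable h : R.
Hypothesis h0 : 0 < h.

Lemma average_continuous : continuous (average h f).
Proof.
move=> x; apply: cvgM; first exact: cvg_cst.
apply: cvgB; last exact: primitive_continuous.
apply: (@continuous_comp _ _ _ (fun y => y + h) (primitive f)); last exact: primitive_continuous.
by apply: cvgD; [exact: cvg_id|exact: cvg_cst].
Qed.

Lemma average_bounded_supported : bounded_supported (c - h) d K (average h f).
Proof.
split.
- exact: continuous_measurable_fun average_continuous.
- move=> x; rewrite /average normrM gtr0_norm ?invr_gt0// mulrC ler_pdivrMr//.
  have xh : x <= x + h by rewrite lerDl ltW.
  by have := primitive_lipschitz xh; rewrite addrAC subrr add0r.
move=> x xcd; rewrite /average primitiveB ?lerDl ?ltW//.
rewrite (_ : Rintegral _ _ _ = 0) ?mulr0//.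
rewrite /Rintegral integral0_eq// => t /=; rewrite in_itv/= => /andP[xt txh].
rewrite f0//; case/orP : xcd => [xc|dx]; apply/orP; [left|right].
  by apply: (le_lt_trans txh); rewrite -ltrBrDr.
exact: lt_trans xt.
Qed.

Lemma average_is_derive (x : R) : continuous f ->
  is_derive x (1 : R) (average h f) (h^-1 * (f (x + h) - f x)).
Proof.
move=> cf.
have dF (y : R) : is_derive y (1 : R) (primitive f) (f y).
  have mNy : measurable (`]-oo, y + 1]%classic : set (measurableTypeR R)) by exact: measurable_itv.
  have y1 : y < y + 1 by rewrite ltrDl.
  have [] := @continuous_FTC1 R f -oo%O y (y + 1) y1 (intf mNy) (ltNyr _) (cf y).
  by move=> dy; rewrite derive1E => <-; apply: DeriveDef.
have dFh : is_derive x (1 : R) (primitive f \o (fun y => y + h)) (f (x + h)).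
  have sh := is_derive_shift x 1 h.
  have := @is_derive1_comp R (primitive f) (fun y => y + h) x _ _ (dF (x + h)) sh.
  by rewrite mulr1.
have := is_deriveZ h^-1 (is_deriveB dFh (dF x)).
exact.
Qed.

End fixed.

(** Lebesgue's differentiation theorem gives convergence almost everywhere, and
    the averages share the bound of [f]. *)
Lemma average_cvg (c d K : R) f (a b : R) eps del :
  bounded_supported c d K f -> 0 < eps -> 0 < del ->
  exists2 h, 0 < h < del & \int[mu]_(x in `[a, b]) (average h f x - f x) ^+ 2 < eps.
Proof.
move=> fP e0 d0; have [mf fK _] := fP.
have mD : measurable (`[a, b]%classic : set (measurableTypeR R)) by exact: measurable_itv.
have intf := bounded_supported_integrable fP.
pose hn n : R := n.+1%:R^-1.
have hn0 n : 0 < hn n by rewrite invr_gt0.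
have hn_cvg : hn n @[n --> \oo] --> (0 : R) by exact: cvg_harmonic.
have ae_cvg : {ae mu, forall x : R, average (hn n) f x @[n --> \oo] --> f x}.
  have intfy (y : R) : mu.-integrable `]-oo, y] (EFin \o f).
    by apply: integrableS intf => //; exact: measurable_itv.
  have := FTC1Ny intfy (open_integrable_locally openT intf).
  apply: filterS; first exact: (ae_filter_ringOfSetsType mu).
  move=> x [dF <-].
  have lP : h^-1 *: (primitive f (h *: 1 + x) - primitive f x) @[h --> 0^'] -->
      'D_1 (primitive f) x by exact: dF.
  rewrite derive1E; have /cvgr_dnbhsP := lP; move=> /(_ hn).
  have hnP : (forall n, hn n != 0) /\ hn n @[n --> \oo] --> (0 : R).
    by split => // n; rewrite gt_eqF.
  move=> /(_ hnP); suff -> : (fun n => (hn n)^-1 *: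
    (primitive f (hn n *: (1 : R) + x) - primitive f x)) = (fun n => average (hn n) f x) by [].
  by apply/funext => n; rewrite /average -[hn n *: _]/(hn n * 1) mulr1 [x + _]addrC.
have mA n : measurable_fun [set: measurableTypeR R] (average (hn n) f).
  by apply: continuous_measurable_fun => x; exact: (average_continuous fP).
have AK n x : `|average (hn n) f x| <= K.
  by have [_ + _] := average_bounded_supported fP (hn0 n); exact.
near \oo => n.
exists (hn n).
  rewrite hn0/=; near: n; exact: (cvgr_lt 0).
near: n; apply: (@dominated_small R a b _ (fun=> (2 * K) ^+ 2)) => //.
- move=> n; apply: measurable_funTS; apply: measurable_funX.
  exact: measurable_funB.
- move: ae_cvg; apply: filterS; first exact: (ae_filter_ringOfSetsType mu).
  move=> x cx _.
  have cB : average (hn n) f x - f x @[n --> \oo] --> f x - f x.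
    by apply: cvgB => //; exact: cvg_cst.
  have cBB : (average (hn n) f x - f x) * (average (hn n) f x - f x) @[n --> \oo]
      --> (f x - f x) * (f x - f x) by exact: (cvgM cB cB).
  by move: cBB; rewrite subrr mul0r.
- by apply: within_continuous_integrable; apply: continuous_subspaceT => t; exact: cvg_cst.
move=> n x _; rewrite sqr_ge0/= -real_normK ?num_real//.
have K0 : 0 <= K by apply: le_trans (fK 0).
rewrite lerXn2r ?nnegrE ?mulr_ge0//.
by apply: (le_trans (ler_normB _ _)); rewrite mulr_natl mulr2n lerD.
Unshelve. all: by end_near. Qed.

End averages.

Section density.
Context {R : realType} (a b : R).
Hypothesis ab : a < b.
Local Notation mu := (@lebesgue_measure R).
Local Notation D := (`[a, b]%classic : set (measurableTypeR R)).
Local Notation sqi := (square_integrable a b).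
Local Notation dist2 u v := (\int[mu]_(x in `[a, b]) (u x - v x) ^+ 2).

Let mD : measurable D. Proof. exact: measurable_itv. Qed.

Lemma dist2_triangle (u v w : R -> R) : sqi u -> sqi v -> sqi w ->
  dist2 u w <= 2 * dist2 u v + 2 * dist2 v w.
Proof.
move=> su sv sw.
have iB (p q : R -> R) : sqi p -> sqi q ->
    mu.-integrable D (EFin \o (fun x => (p x - q x) ^+ 2)).
  move=> sp sq; have [_] := square_integrableD (-1) sp sq.
  by apply: eq_integrable => // x _ /=; rewrite mulN1r.
have iuv := integrable_scale 2 (iB _ _ su sv).
have ivw := integrable_scale 2 (iB _ _ sv sw).
rewrite -!RintegralZl//; try exact: iB.
rewrite -RintegralD//; apply: le_Rintegral => //.
- exact: iB.
- exact: (integrable_lin 2 iuv (iB _ _ sv sw)).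
move=> x _; have := sqr_ge0 ((u x - v x) - (v x - w x)); rewrite !expr2; lra.
Qed.

Lemma bounded_supported_sqi c d K (f : R -> R) : bounded_supported c d K f -> sqi f.
Proof.
move=> [mf fK _]; split; first exact: measurable_funTS.
apply: measurable_bounded_integrable => //.
- by apply: compact_finite_measure; exact: segment_compact.
- by apply: measurable_funX; exact: measurable_funTS.
- exists (K ^+ 2); split; rewrite ?num_real// => M KM x _ /=.
  rewrite normrX; apply: le_trans (ltW KM).
  by rewrite lerXn2r ?nnegrE// (le_trans (normr_ge0 _) (fK x)).
Qed.

(** The cut-off near the end points leaves room for the supports of the averages,
    which extend to the left of the support of the averaged function. *)
Lemma L2_truncation (f : L2 a b) eps : 0 < eps ->
  exists c d K f0, [/\ a < c, d < b, bounded_supported c d K f0 & dist2 f f0 < eps].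
Proof.
move=> e0.
pose h n : R := n.+1%:R^-1.
have h0 n : 0 < h n by rewrite invr_gt0.
have h_cvg : h n @[n --> \oo] --> (0 : R) by exact: cvg_harmonic.
pose A n : set (measurableTypeR R) := `[a + h n, b - h n]%classic `&` [set x | `|f x| <= n%:R].
have mf := L2_measurable f.
have mA n : measurable (A n).
  apply: measurableI; first exact: measurable_itv.
  have mnf : measurable_fun [set: measurableTypeR R] (fun x => `|f x|) by exact: measurableT_comp.
  have := mnf measurableT `]-oo, n%:R]%classic (measurable_itv _).
  by rewrite setTI; congr (measurable _); apply/seteqP; split => x /=; rewrite in_itv.
pose g n := (f : measurableTypeR R -> R) \_ (A n).
have gP n : bounded_supported (a + h n) (b - h n) n%:R (g n).
  split.
  - have mfA : measurable_fun (A n) (f : measurableTypeR R -> R) by exact: measurable_funTS mf.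
    by apply/(measurable_restrictT _ _).1 => //; exact: mA.
  - by move=> x; rewrite /g patchE; case: ifPn => [/set_mem[]//|_]; rewrite normr0.
  - move=> x xcd; rewrite /g patchE; case: ifPn => // /set_mem[/=].
    by rewrite in_itv/= => /andP[]; case/orP : xcd; rewrite ltNge => /negPf ->.
have ae_cvg : {ae mu, forall x, D x -> (f x - g n x) ^+ 2 @[n --> \oo] --> (0 : R)}.
  exists ([set a] `|` [set b]); split; first exact: measurableU.
    by apply: null_set_setU => //; exact: lebesgue_measure_set1.
  move=> x /= /not_implyP[]; rewrite in_itv/= => /andP[ax xb] ncvg.
  apply: contrapT => /not_orP[/eqP xNa /eqP xNb]; apply: ncvg.
  have {}ax : 0 < x - a by rewrite subr_gt0 lt_neqAle eq_sym xNa.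
  have {}xb : 0 < b - x by rewrite subr_gt0 lt_neqAle xNb.
  apply: cvg_near_cst; near=> n.
  rewrite /g patchE ifT ?subrr ?expr0n// inE; split => /=.
    have h1 : h n <= x - a by near: n; exact: (cvgr_le 0).
    have h2 : h n <= b - x by near: n; exact: (cvgr_le 0).
    by rewrite in_itv/=; apply/andP; split; lra.
  by near: n; exact: nbhs_infty_ger.
have [mfD f2] := L2_square_integrable f.
have gsq n := bounded_supported_sqi (gP n).
have small : \forall n \near \oo, dist2 f (g n) < eps.
  apply: (@dominated_small R a b _ (fun x => f x ^+ 2)) => //.
  - move=> n; apply: measurable_funX; apply: measurable_funB => //.
    by have [] := gsq n.
  - move=> n x _; rewrite sqr_ge0/= /g patchE; case: ifPn => _.
      by rewrite subrr expr0n sqr_ge0.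
    by rewrite subr0.
have [n _ /(_ n (leqnn _)) ns] := small.
exists (a + h n), (b - h n), n%:R, (g n); split => //.
- by rewrite ltrDl.
- by rewrite gtrBl.
Unshelve. all: by end_near. Qed.

(** Averaging once makes a function continuous, and each further average gains
    one derivative. *)
Lemma L2_smooth_approximation (f : L2 a b) eps : 0 < eps ->
  exists g u u1 g2, [/\ H2_data g (u, u1, g2),
    u a = 0 /\ u1 a = 0, u b = 0 /\ u1 b = 0 & dot (f - g) (f - g) < eps].
Proof.
(* The squared triangle inequality doubles at every step, so that the four
   distances enter with the weights 2, 4, 8 and 8. *)
move=> e0; have e22 : 0 < eps / 22 by rewrite divr_gt0.
have [c [d [K [f0 [ac db f0P ff0]]]]] := L2_truncation f e22.
(* Three averages, and one more translation in the derivatives, move the support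
   to the left; four steps fit between [a] and [c]. *)
have del0 : 0 < (c - a) / 4 by rewrite divr_gt0// subr_gt0.
have [h1 /andP[h10 h1d] d1] := average_cvg a b f0P e22 del0.
have f1P := average_bounded_supported f0P h10.
have c1 := average_continuous f0P (h := h1).
have [h2 /andP[h20 h2d] d2] := average_cvg a b f1P e22 del0.
have f2P := average_bounded_supported f1P h20.
have c2 := average_continuous f1P (h := h2).
have [h3 /andP[h30 h3d] d3] := average_cvg a b f2P e22 del0.
have f3P := average_bounded_supported f2P h30.
have left3 : a < c - h1 - h2 - h3 by clear - h1d h2d h3d ac; lra.
have left2 : a + h3 < c - h1 - h2 by clear - h1d h2d h3d ac; lra.
have left2' : a < c - h1 - h2 by rewrite (le_lt_trans _ left2)// lerDl ltW.
have right2 : d < b + h3 by rewrite (lt_le_trans db)// lerDl ltW.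
set f1 := average h1 f0 in d1 f1P c1 d2 f2P c2 d3 f3P.
set f2 := average h2 f1 in d2 f2P c2 d3 f3P.
set f3 := average h3 f2 in d3 f3P.
pose u1 x := h3^-1 * (f2 (x + h3) - f2 x).
pose f2' x := h2^-1 * (f1 (x + h2) - f1 x).
pose u2 x := h3^-1 * (f2' (x + h3) - f2' x).
have du (x : R) : is_derive x (1 : R) f3 (u1 x) by exact: (average_is_derive f2P).
have df2 (x : R) : is_derive x (1 : R) f2 (f2' x) by exact: (average_is_derive f1P).
have du1 (x : R) : is_derive x (1 : R) u1 (u2 x).
  have sh : is_derive x (1 : R) (fun y => f2 (y + h3)) (f2' (x + h3)).
    have := @is_derive1_comp R f2 (fun y => y + h3) x _ _ (df2 (x + h3)) (is_derive_shift x 1 h3).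
    by rewrite mulr1.
  exact: (is_deriveZ h3^-1 (is_deriveB sh (df2 x))).
have cshift (p : R -> R) k : continuous p -> continuous (fun x => p (x + k)).
  move=> cp x; apply: (@continuous_comp _ _ _ (fun y => y + k) p); last exact: cp.
  by apply: cvgD; [exact: cvg_id|exact: cvg_cst].
have cdiff (p : R -> R) h k : continuous p -> continuous (fun x => k * (p (x + h) - p x)).
  move=> cp x; apply: cvgM; first exact: cvg_cst.
  by apply: cvgB; [exact: (cshift p h cp)|exact: cp].
have cu1 : continuous u1 by exact: (cdiff).
have cu2 : continuous u2 by apply: (cdiff); exact: (cdiff).
have su2 := continuous_sqi a b cu2.
pose g := L2_of a b f3; pose g2 := L2_of a b u2.
have s3 : sqi f3 := bounded_supported_sqi f3P.
have gE : ae_eq mu D g f3 by exact: L2_ofE.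
have g2E : ae_eq mu D g2 u2 by exact: L2_ofE.
have f2z x : (x < c - h1 - h2) || (d < x) -> f2 x = 0 by have [_ _] := f2P; apply.
have f3z x : (x < c - h1 - h2 - h3) || (d < x) -> f3 x = 0 by have [_ _] := f3P; apply.
exists g, f3, u1, g2; split.
- split => //=.
    exact: (primitive_on_is_derive a b cu1 du).
  apply: (primitive_on_ae _ (ae_eq_sym g2E) (primitive_on_is_derive a b cu2 du1)).
  by have [] := L2_square_integrable g2.
- split; first by rewrite f3z ?left3.
  by rewrite /u1 !f2z ?left2 ?left2'// subrr mulr0.
- split; first by rewrite f3z ?db ?orbT.
  by rewrite /u1 !f2z ?db ?right2 ?orbT// subrr mulr0.
have s0 := bounded_supported_sqi f0P; have s1 := bounded_supported_sqi f1P.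
have s2 := bounded_supported_sqi f2P; have sf := L2_square_integrable f.
have fgE : ae_eq mu D (f - g : L2 a b) (fun x => f x + -1 * f3 x).
  rewrite -scaleN1r; apply: ae_eq_trans (L2_linE _ _ _) _.
  by apply: filterS gE => x gE Dx; rewrite gE.
have sfg := square_integrableD (-1) sf s3.
rewrite (dotE sfg sfg fgE fgE).
rewrite [ltLHS](_ : _ = dist2 f f3); last first.
  by apply: eq_Rintegral => x _; rewrite mulN1r expr2.
have t1 := dist2_triangle sf s0 s3; have t2 := dist2_triangle s0 s1 s3.
have t3 := dist2_triangle s1 s2 s3.
have sym (p q : R -> R) : dist2 p q = dist2 q p.
  by apply: eq_Rintegral => x _; rewrite -sqrrN opprB.
rewrite (sym f1) in d1; rewrite (sym f2) in d2; rewrite (sym f3) in d3.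
have arith (x y z w s t r : R) : x < eps / 22 -> y < eps / 22 -> z < eps / 22 ->
    w < eps / 22 -> r <= 2 * x + 2 * s -> s <= 2 * y + 2 * t -> t <= 2 * z + 2 * w -> r < eps.
  by clear; lra.
exact: arith ff0 d1 d2 d3 t1 t2 t3.
Qed.

End density.

Section domain_density.
Context {R : realType}.

(** Subtracting the Taylor polynomial of the prescribed jet reduces to functions
    that vanish to first order at the endpoint. *)
Lemma L2_approximation_with_jet (p q : R) (pq : p < q) (o s t : R) (f : L2 p q) eps :
  o = p \/ o = q -> 0 < eps ->
  exists g, [/\ H2 g, H2_val g o = s, H2_deriv g o = t & dot (f - g) (f - g) < eps].
Proof.
move=> opq e0; pose aff := 0 + (s - o * t) *: L2_one p q + t *: L2_id p q.
have H0 : H2_data (0 : L2 p q) (fun=> 0, fun=> 0, 0).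
  have := H2_data_lin (-1) (H2_one p q) (H2_one p q).
  rewrite !scaleN1r !subrr; congr H2_data; congr (_, _, _); apply/funext => x; ring.
have affP := H2_data_lin t (H2_data_lin (s - o * t) H0 (H2_one p q)) (H2_id p q).
have [g [u [u1 [g2 [gP [ua u1a] [ub u1b] gf]]]]] :=
  L2_smooth_approximation (f - aff) e0.
have hP := H2_data_lin 1 gP affP.
have u0 : u o = 0 by case: opq => ->.
have u10 : u1 o = 0 by case: opq => ->.
have oD : `[p, q]%classic o.
  by case: opq => ->; rewrite /= in_itv/= lexx ltW.
have [v0 v1] := H2_val_derivE pq hP oD.
exists (g + 1 *: aff); split.
- by eexists; exact: hP.
- by rewrite v0 u0 /=; ring.
- by rewrite v1 u10 /=; ring.
by rewrite scale1r opprD [- g - _]addrC addrA.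
Qed.

End domain_density.

(** * The decay estimate as a real inequality *)

Section arithmetic.
Context {R : realType}.
Implicit Types (x y eta : R).

Lemma young eta x y : 0 < eta -> x * y <= eta * x ^+ 2 + (4 * eta)^-1 * y ^+ 2.
Proof.
move=> e0; rewrite -subr_ge0.
have -> : eta * x ^+ 2 + (4 * eta)^-1 * y ^+ 2 - x * y =
    (4 * eta)^-1 * (2 * eta * x - y) ^+ 2.
  by field; rewrite gt_eqF.
by rewrite mulr_ge0 ?sqr_ge0// invr_ge0 mulr_ge0// ltW.
Qed.

Lemma sqr_le_norm (C z x y : R) : 0 <= C -> 0 <= x -> 0 <= y ->
  z ^+ 2 <= C * x ^+ 2 * y ^+ 2 -> `|z| <= (1 + C) * x * y.
Proof.
move=> C0 x0 y0 zC; have C1 : 0 <= 1 + C by rewrite addr_ge0.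
rewrite -(@ler_pXn2r _ 2)// ?nnegrE ?mulr_ge0// real_normK ?num_real//.
apply: (le_trans zC); rewrite !exprMn !ler_wpM2r ?sqr_ge0//.
by have := sqr_ge0 C; rewrite !expr2; lra.
Qed.

(** The left-hand side is the derivative of the Lyapunov functional: [a2] and
    [b2] are the squared norms of the momenta and of the curvatures, [c1] and [c2]
    the velocities of the body, [M0] and [M1] the linear and the angular momentum
    of the beams, [F0] and [F1] the moments of the deflection, and [G] is the
    virial. Young's inequality bounds every mixed product by a fraction of
    [k b2 + m c1 ^ 2 + Im c2 ^ 2] and a multiple of [a2]. These multiples add up
    to [Q], which the friction term outweighs for large [N]. *)
Lemma lyapunov_arithmetic (r k m Im gamma K : R) :
  0 < r -> 0 < k -> 0 < m -> 0 < Im -> 0 < gamma -> 0 < K ->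
  exists N0, forall N a2 b2 c1 c2 M0 M1 F0 F1 G, N0 <= N -> 0 <= a2 -> 0 <= b2 ->
  M0 ^+ 2 <= K * a2 -> M1 ^+ 2 <= K * a2 -> F0 ^+ 2 <= K * b2 -> F1 ^+ 2 <= K * b2 ->
  G ^+ 2 <= K * a2 * b2 ->
  - 2 * N * gamma * r ^+ 2 * a2
  + (- gamma * r * G - k * b2 + r * a2 - c1 * M0 - c2 * M1)
  + (- gamma * r * M0 * F0 + (m * c1 + M0) * (r * M0 - 2 * c1))
  + (- gamma * r * M1 * F1 + (Im * c2 + M1) * (r * M1 - 2 / 3 * c2))
  <= - 3^-1 * (r * a2 + k * b2 + m * c1 ^+ 2 + Im * c2 ^+ 2).
Proof.
move=> r0 k0 m0 I0 g0 K0.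
set g := gamma * r.
have gr0 : 0 < g by rewrite mulr_gt0.
pose eF := k / (8 * K).
have eF0 : 0 < eF by rewrite divr_gt0// mulr_gt0.
pose qG := g ^+ 2 * K / k.
pose qF := (4 * eF)^-1 * g ^+ 2.
pose q1 := (4 * m)^-1 * (m * r - 3) ^+ 2.
pose q2 := (4 * (Im / 3))^-1 * (Im * r - 5 / 3) ^+ 2.
pose Q := qG + K * (2 * qF + q1 + q2 + 2 * r) + 2 * r.
exists (Q / (2 * gamma * r ^+ 2)) => N a2 b2 c1 c2 M0 M1 F0 F1 G NN a0 b0 hM0 hM1 hF0 hF1 hG.
have den0 : 0 < 2 * gamma * r ^+ 2 by rewrite !mulr_gt0// exprn_gt0.
have NQ : Q * a2 <= 2 * N * gamma * r ^+ 2 * a2.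
  rewrite ler_wpM2r//; move: NN; rewrite ler_pdivrMr//; lra.
have yG : - g * G <= k / 4 * b2 + qG * a2.
  have p0 : 0 <= k / 4 * b2 + qG * a2.
    have k0' := ltW k0; have K0' := ltW K0.
    have qG0 : 0 <= qG by rewrite divr_ge0// mulr_ge0// sqr_ge0.
    by apply: addr_ge0; apply: mulr_ge0 => //; exact: divr_ge0.
  apply: (le_trans (ler_norm _)).
  rewrite -(@ler_pXn2r _ 2)// ?nnegrE// real_normK ?num_real//.
  apply: (@le_trans _ _ (g ^+ 2 * (K * a2 * b2))).
    by rewrite exprMn sqrrN ler_wpM2l ?sqr_ge0.
  rewrite -subr_ge0.
  have -> : (k / 4 * b2 + qG * a2) ^+ 2 - g ^+ 2 * (K * a2 * b2) =
     (k / 4 * b2 - qG * a2) ^+ 2 by rewrite /qG; field; rewrite gt_eqF.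
  exact: sqr_ge0.
have yF (M F : R) : M ^+ 2 <= K * a2 -> F ^+ 2 <= K * b2 ->
    - g * M * F <= k / 8 * b2 + qF * (K * a2).
  move=> hM hF; have := young F (- g * M) eF0; rewrite exprMn sqrrN.
  have : eF * F ^+ 2 <= k / 8 * b2.
    have -> : k / 8 * b2 = eF * (K * b2) by rewrite /eF; field; rewrite gt_eqF.
    by rewrite ler_pM2l.
  have : (4 * eF)^-1 * (g ^+ 2 * M ^+ 2) <= qF * (K * a2).
    rewrite mulrA; apply: ler_wpM2l => //.
    by rewrite mulr_ge0 ?sqr_ge0// invr_ge0 mulr_ge0// ltW.
  lra.
have y0 := yF _ _ hM0 hF0; have y1 := yF _ _ hM1 hF1.
have i3 : 0 < Im / 3 by rewrite divr_gt0.
have yc1 : c1 * ((m * r - 3) * M0) <= m * c1 ^+ 2 + q1 * (K * a2).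
  apply: (le_trans (young _ _ m0)); rewrite lerD2l exprMn mulrA; apply: ler_wpM2l => //.
  by rewrite mulr_ge0 ?sqr_ge0// invr_ge0 mulr_ge0// ltW.
have yc2 : c2 * ((Im * r - 5 / 3) * M1) <= Im / 3 * c2 ^+ 2 + q2 * (K * a2).
  apply: (le_trans (young _ _ i3)); rewrite lerD2l exprMn [_ * (_ * M1 ^+ 2)]mulrA; apply: ler_wpM2l => //.
  by rewrite mulr_ge0 ?sqr_ge0// invr_ge0 mulr_ge0// ltW.
have rM0 : r * M0 ^+ 2 <= r * (K * a2) by rewrite ler_pM2l.
have rM1 : r * M1 ^+ 2 <= r * (K * a2) by rewrite ler_pM2l.
have ra : 0 <= r * a2 by rewrite mulr_ge0// ltW.
have kb : 0 <= k * b2 by rewrite mulr_ge0// ltW.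
have mc : 0 <= m * c1 ^+ 2 by rewrite mulr_ge0 ?sqr_ge0// ltW.
have Ic : 0 <= Im * c2 ^+ 2 by rewrite mulr_ge0 ?sqr_ge0// ltW.
have QE : Q * a2 = qG * a2 + 2 * (qF * (K * a2)) + q1 * (K * a2) + q2 * (K * a2)
   + 2 * (r * (K * a2)) + 2 * (r * a2) by rewrite /Q; ring.
rewrite QE in NQ.
have -> : (m * c1 + M0) * (r * M0 - 2 * c1) = c1 * ((m * r - 3) * M0) + c1 * M0
   - 2 * (m * c1 ^+ 2) + r * M0 ^+ 2 by ring.
have -> : (Im * c2 + M1) * (r * M1 - 2 / 3 * c2) = c2 * ((Im * r - 5 / 3) * M1) + c2 * M1
   - 2 / 3 * (Im * c2 ^+ 2) + r * M1 ^+ 2 by field.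
have -> : - gamma * r * G = - g * G by rewrite /g; ring.
have -> : - gamma * r * M0 * F0 = - g * M0 * F0 by rewrite /g; ring.
have -> : - gamma * r * M1 * F1 = - g * M1 * F1 by rewrite /g; ring.
have -> : - 2 * N * gamma * r ^+ 2 * a2 = - (2 * N * gamma * r ^+ 2 * a2) by ring.
lra.
Qed.

End arithmetic.

(** * Identities on one beam *)

Section beam.
Context {R : realType} (p q : R).
Hypothesis pq : p < q.
Local Notation mu := (@lebesgue_measure R).
Local Notation D := (`[p, q]%classic : set (measurableTypeR R)).
Local Notation one := (L2_one p q).
Local Notation idc := (L2_id p q).
Local Notation J2 := (L2_antideriv2 0).

Let qD : D q. Proof. by rewrite /= in_itv/= lexx ltW. Qed.

Lemma dot0r (h : L2 p q) : dot h 0 = 0.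
Proof. by have := dot_linr (0 : L2 p q) 0 h (-1); rewrite scaleN1r subrr => ->; ring. Qed.

Lemma dotZr (h f : L2 p q) c : dot h (c *: f) = c * dot h f.
Proof. by have := dot_linr 0 f h c; rewrite add0r dot0r add0r. Qed.

Lemma dotNr (h f : L2 p q) : dot h (- f) = - dot h f.
Proof. by rewrite -scaleN1r dotZr mulN1r. Qed.

Lemma dotDr (h f g : L2 p q) : dot h (f + g) = dot h f + dot h g.
Proof. by rewrite -[g in LHS]scale1r dot_linr mul1r. Qed.

Lemma dot_one_deriv2 (f : L2 p q) : H2 f ->
  dot one (H2_deriv2 f) = H2_deriv f q - H2_deriv f p.
Proof.
move=> /H2_getP fP; have := green pq (H2_one p q) fP.
by rewrite dot0r subr0 => ->; ring.
Qed.

Lemma dot_id_deriv2 (f : L2 p q) : H2 f ->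
  dot idc (H2_deriv2 f) =
  (q * H2_deriv f q - H2_val f q) - (p * H2_deriv f p - H2_val f p).
Proof.
move=> /H2_getP fP; have := green pq (H2_id p q) fP.
by rewrite dot0r subr0 => ->; ring.
Qed.

Hypothesis D0 : D 0.

(** With [f] a momentum, this is, up to the factor [r], the time derivative of the
    deflection, tested against [h]. *)
Lemma dot_antideriv2_deriv2 (h f : L2 p q) : H2 f ->
  dot h (J2 (H2_deriv2 f)) =
  dot h f - H2_val f 0 * dot h one - H2_deriv f 0 * dot h idc.
Proof.
move=> /H2_getP fP; rewrite (L2_antideriv2_deriv2 pq D0 fP) !dot_linr.
by rewrite mul0r subr0; ring.
Qed.

(** The boundary terms vanish at [0], where the beam is attached, because of
    [J2 f], and at the free end [o] because of [f]. *)
Lemma dot_deriv2_antideriv2 (o : R) (f : L2 p q) : H2 f ->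
  (p = o /\ q = 0) \/ (p = 0 /\ q = o) ->
  H2_val f o = 0 -> H2_deriv f o = 0 ->
  dot (H2_deriv2 f) (J2 f) = dot f f.
Proof.
move=> /H2_getP fP po f0 f10.
have [w [w1 [wP w0 w10]]] := L2_antideriv2_data pq 0 f.
have := green pq wP fP; rewrite dotC => /eqP; rewrite subr_eq => /eqP ->.
case: po => -[po qo].
  have -> : w q = 0 by rewrite qo.
  have -> : w1 q = 0 by rewrite qo.
  by have := f0; have := f10; rewrite -po => -> ->; ring.
have -> : w p = 0 by rewrite po.
have -> : w1 p = 0 by rewrite po.
by have := f0; have := f10; rewrite -qo => -> ->; ring.
Qed.

Lemma Rintegral_is_derive (u v : R -> R) :
  continuous v -> (forall x : R, is_derive x (1 : R) u (v x)) ->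
  \int[mu]_(x in D) v x = u q - u p.
Proof.
move=> cv du; have [_ /(_ q qD) ->] := primitive_on_is_derive p q cv du; ring.
Qed.

Let cst_sqi : square_integrable p q (fun=> 1).
Proof. by apply: continuous_sqi => x; exact: cvg_cst. Qed.

Let id_sqi : square_integrable p q id.
Proof. by apply: continuous_sqi => x; exact: cvg_id. Qed.

Lemma dot_one_one : dot one one = q - p.
Proof.
rewrite (dotE cst_sqi cst_sqi (L2_oneE p q) (L2_oneE p q)) mulr1.
rewrite (@Rintegral_is_derive id (fun=> 1))// => x; exact: cvg_cst.
Qed.

Lemma dot_one_id : dot one idc = (q ^+ 2 - p ^+ 2) / 2.
Proof.
rewrite (dotE cst_sqi id_sqi (L2_oneE p q) (L2_idE p q)).
under eq_Rintegral do rewrite mul1r.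
have du (x : R) : is_derive x (1 : R) (fun y : R => 2^-1 * y ^+ 2) x.
  have d := is_deriveZ 2^-1 (is_deriveX 2 (is_derive_id x (1 : R))).
  suff E : 2^-1 *: ((2%:R * x ^+ 2.-1) *: (1 : R)) = x by rewrite E in d; exact: d.
  by rewrite /= expr1 -[LHS]/(2^-1 * (2 * x * 1)) mulr1 mulKf// pnatr_eq0.
rewrite (@Rintegral_is_derive (fun y => 2^-1 * y ^+ 2) id)//.
  by ring.
by move=> x; exact: cvg_id.
Qed.

Lemma dot_id_id : dot idc idc = (q ^+ 3 - p ^+ 3) / 3.
Proof.
rewrite (dotE id_sqi id_sqi (L2_idE p q) (L2_idE p q)).
have du (x : R) : is_derive x (1 : R) (fun y : R => 3^-1 * y ^+ 3) (x ^+ 2).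
  have d := is_deriveZ 3^-1 (is_deriveX 3 (is_derive_id x (1 : R))).
  suff E : 3^-1 *: ((3%:R * x ^+ 3.-1) *: (1 : R)) = x ^+ 2 by rewrite E in d; exact: d.
  by rewrite -[LHS]/(3^-1 * (3 * x ^+ 2 * 1)) mulr1 mulKf// pnatr_eq0.
rewrite (@Rintegral_is_derive (fun y => 3^-1 * y ^+ 3) (fun x => x ^+ 2))//.
  by ring.
exact: exprn_continuous.
Qed.

End beam.

(** * The coupled system *)

Section satellite.
Context {R : realType} (rho a E I gamma m I_m : R).
Hypotheses (rho_gt0 : 0 < rho) (a_gt0 : 0 < a) (E_gt0 : 0 < E) (I_gt0 : 0 < I).
Hypotheses (gamma_gt0 : 0 < gamma) (m_gt0 : 0 < m) (I_m_gt0 : 0 < I_m).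
Local Notation X := (X R).
Local Notation nrm := (X_norm rho a E I m I_m).
Local Notation dom := (satellite_dom rho a).
Local Notation op := (satellite_op rho a E I gamma m I_m).

Let r := (rho * a)^-1.
Let k := E * I.
Let r_gt0 : 0 < r. Proof. by rewrite invr_gt0 mulr_gt0. Qed.
Let k_gt0 : 0 < k. Proof. by rewrite mulr_gt0. Qed.

Let N10 : (-1 : R) < 0. Proof. by rewrite ltrN10. Qed.
Let P01 : (0 : R) < 1. Proof. exact: ltr01. Qed.
Let N10D0 : `[(-1 : R), 0]%classic 0. Proof. by rewrite /= in_itv/= lexx ltW. Qed.
Let P01D0 : `[(0 : R), 1]%classic 0. Proof. by rewrite /= in_itv/= lexx ltW. Qed.

(* The momentum densities and the curvatures of the left and of the right beam,
   the velocity and the angular velocity of the body. *)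
Local Notation mom_l x := (x.1.1.1).
Local Notation cur_l x := (x.1.1.2).
Local Notation mom_r x := (x.1.2.1).
Local Notation cur_r x := (x.1.2.2).
Local Notation vel x := (x.2 0 0).
Local Notation rot x := (x.2 1 0).
Local Notation one_l := (L2_one (-1 : R) 0).
Local Notation id_l := (L2_id (-1 : R) 0).
Local Notation one_r := (L2_one (0 : R) 1).
Local Notation id_r := (L2_id (0 : R) 1).
Local Notation J2 := (L2_antideriv2 0).

Definition inner (x y : X) : R :=
  r * (dot (mom_l x) (mom_l y) + dot (mom_r x) (mom_r y)) +
  k * (dot (cur_l x) (cur_l y) + dot (cur_r x) (cur_r y)) +
  m * (vel x * vel y) + I_m * (rot x * rot y).

Lemma beam_norm_sqr c d (x : beam_space c d) :
  beam_norm rho a E I x ^+ 2 = r * dot x.1 x.1 + k * dot x.2 x.2.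
Proof.
have [_ i1] := L2_square_integrable x.1; have [_ i2] := L2_square_integrable x.2.
rewrite sqr_sqrtr; last first.
  apply: Rintegral_ge0 => t _.
  by rewrite addr_ge0// mulr_ge0 ?sqr_ge0// ltW.
have mD : measurable (`[c, d]%classic : set (measurableTypeR R)) by exact: measurable_itv.
rewrite /dot -!RintegralZl// -RintegralD//; try exact: integrable_scale.
by apply: eq_Rintegral => t _; rewrite !real_normK ?num_real// !expr2.
Qed.

Lemma Xb_norm_sqr (x : Xb (R := R)) : Xb_norm rho a E I x ^+ 2 =
  (r * dot x.1.1 x.1.1 + k * dot x.1.2 x.1.2) +
  (r * dot x.2.1 x.2.1 + k * dot x.2.2 x.2.2).
Proof.
have n0 : 0 <= beam_norm rho a E I x.1 ^+ 2 + beam_norm rho a E I x.2 ^+ 2.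
  by apply: addr_ge0; exact: sqr_ge0.
by rewrite [LHS](sqr_sqrtr n0) -!beam_norm_sqr.
Qed.

Lemma Xc_norm_sqr (x : 'cV[R]_2) :
  Xc_norm m I_m x ^+ 2 = m * x 0 0 ^+ 2 + I_m * x 1 0 ^+ 2.
Proof.
have n0 : 0 <= m * `|x 0 0| ^+ 2 + I_m * `|x 1 0| ^+ 2.
  by apply: addr_ge0; apply: mulr_ge0; rewrite ?sqr_ge0// ltW.
by rewrite [LHS](sqr_sqrtr n0) !real_normK ?num_real.
Qed.

Lemma X_norm_sqr x : nrm x ^+ 2 = inner x x.
Proof.
have n0 : 0 <= Xb_norm rho a E I x.1 ^+ 2 + Xc_norm m I_m x.2 ^+ 2.
  by apply: addr_ge0; exact: sqr_ge0.
by rewrite [LHS](sqr_sqrtr n0) Xb_norm_sqr Xc_norm_sqr /inner !expr2; ring.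
Qed.

Lemma X_norm_ge0 x : 0 <= nrm x.
Proof. exact: sqrtr_ge0. Qed.

Lemma innerC x y : inner x y = inner y x.
Proof.
rewrite /inner !(dotC (mom_l x)) !(dotC (mom_r x)) !(dotC (cur_l x)) !(dotC (cur_r x)).
by rewrite (mulrC (vel x)) (mulrC (rot x)).
Qed.

Lemma innerDl h x y z : inner (x + h *: y) z = inner x z + h * inner y z.
Proof. by rewrite /inner /= !mxE !dot_linl; ring. Qed.

Lemma inner_ge0 x : 0 <= inner x x.
Proof. by rewrite -X_norm_sqr sqr_ge0. Qed.

Lemma innerDr h x y z : inner z (x + h *: y) = inner z x + h * inner z y.
Proof. by rewrite innerC innerDl !(innerC z). Qed.

Lemma X_normZ h x : nrm (h *: x) = `|h| * nrm x.
Proof.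
apply/eqP; rewrite -(@eqrXn2 _ 2)// ?mulr_ge0 ?X_norm_ge0// exprMn !X_norm_sqr.
have z0 (z : X) : inner 0 z = 0.
  by have := innerDl (-1) (0 : X) 0 z; rewrite scaleN1r subrr => ->; ring.
have Zl (y z : X) : inner (h *: y) z = h * inner y z.
  by have := innerDl h 0 y z; rewrite add0r z0 add0r.
by rewrite real_normK ?num_real// Zl innerC Zl; apply/eqP; ring.
Qed.

Lemma X_normD x y : nrm (x + y) <= nrm x + nrm y.
Proof.
have n0 := X_norm_ge0.
rewrite -(@ler_pXn2r _ 2)// ?nnegrE ?addr_ge0// -[y in nrm (x + y)]scale1r.
rewrite X_norm_sqr innerDl !innerDr !mul1r (innerC y x) sqrrD !X_norm_sqr.
have cs : inner x y <= nrm x * nrm y.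
  apply: (le_trans (ler_norm _)).
  rewrite -(@ler_pXn2r _ 2)// ?nnegrE ?mulr_ge0// real_normK ?num_real//.
  rewrite exprMn !X_norm_sqr.
  by apply: form_cauchy_schwarz; [exact: innerC|move=> *; exact: innerDl|exact: inner_ge0].
lra.
Qed.

(** Bounds are stated for squares, which lets them be combined without square
    roots. *)
Definition vec_bounded p q (f : X -> L2 p q) :=
  exists2 K, 0 <= K & forall x, dot (f x) (f x) <= K * nrm x ^+ 2.
Definition lin_bounded (f : X -> R) :=
  exists2 K, 0 <= K & forall x, f x ^+ 2 <= K * nrm x ^+ 2.
Definition bil_bounded (B : X -> X -> R) :=
  exists2 K, 0 <= K & forall x y, B x y ^+ 2 <= K * nrm x ^+ 2 * nrm y ^+ 2.

Lemma bil_boundedD B B' : bil_bounded B -> bil_bounded B' ->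
  bil_bounded (fun x y => B x y + B' x y).
Proof.
move=> [K K0 BK] [K' K'0 BK']; exists (2 * (K + K')).
  by rewrite mulr_ge0// addr_ge0.
move=> x y; have := BK x y; have := BK' x y; have := sqr_ge0 (B x y - B' x y).
by rewrite !expr2; lra.
Qed.

Lemma bil_boundedM f g : lin_bounded f -> lin_bounded g ->
  bil_bounded (fun x y => f x * g y).
Proof.
move=> [K K0 fK] [K' K'0 gK]; exists (K * K'); first exact: mulr_ge0.
move=> x y; rewrite exprMn.
rewrite (_ : K * K' * _ * _ = (K * nrm x ^+ 2) * (K' * nrm y ^+ 2)); last by ring.
by apply: ler_pM; rewrite ?sqr_ge0.
Qed.

Lemma bil_bounded_dot p q (f g : X -> L2 p q) : vec_bounded f -> vec_bounded g ->
  bil_bounded (fun x y => dot (f x) (g y)).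
Proof.
move=> [K K0 fK] [K' K'0 gK]; exists (K * K'); first exact: mulr_ge0.
move=> x y; apply: (le_trans (cauchy_schwarz _ _)).
rewrite (_ : K * K' * _ * _ = (K * nrm x ^+ 2) * (K' * nrm y ^+ 2)); last by ring.
by apply: ler_pM; rewrite ?dot_ge0.
Qed.

Lemma lin_boundedD f g : lin_bounded f -> lin_bounded g ->
  lin_bounded (fun x => f x + g x).
Proof.
move=> [K K0 fK] [K' K'0 gK]; exists (2 * (K + K')).
  by rewrite mulr_ge0// addr_ge0.
move=> x; have := fK x; have := gK x; have := sqr_ge0 (f x - g x).
by rewrite !expr2; lra.
Qed.

Lemma lin_boundedZ c f : lin_bounded f -> lin_bounded (fun x => c * f x).
Proof.
move=> [K K0 fK]; exists (c ^+ 2 * K); first by rewrite mulr_ge0 ?sqr_ge0.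
by move=> x; rewrite exprMn -[leRHS]mulrA ler_wpM2l ?sqr_ge0.
Qed.

Lemma lin_bounded_dot p q (h : L2 p q) f : vec_bounded f ->
  lin_bounded (fun x => dot h (f x)).
Proof.
move=> [K K0 fK]; exists (dot h h * K); first by rewrite mulr_ge0 ?dot_ge0.
move=> x; apply: (le_trans (cauchy_schwarz _ _)).
by rewrite -[leRHS]mulrA ler_wpM2l ?dot_ge0.
Qed.

Lemma vec_bounded_antideriv2 p q (pq : p < q) (D0 : `[p, q]%classic 0) (f : X -> L2 p q) :
  vec_bounded f -> vec_bounded (fun x => J2 (f x)).
Proof.
move=> [K K0 fK]; exists ((4 * (q - p) ^+ 2) ^+ 2 * K); first by rewrite mulr_ge0 ?sqr_ge0.
move=> x; apply: (le_trans (L2_antideriv2_bounded pq D0 (f x))).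
by rewrite -[leRHS]mulrA ler_wpM2l ?sqr_ge0.
Qed.

Lemma inner_parts x :
  [/\ r * dot (mom_l x) (mom_l x) <= inner x x,
      r * dot (mom_r x) (mom_r x) <= inner x x,
      k * dot (cur_l x) (cur_l x) <= inner x x,
      k * dot (cur_r x) (cur_r x) <= inner x x &
      m * vel x ^+ 2 <= inner x x /\ I_m * rot x ^+ 2 <= inner x x].
Proof.
have p1 : 0 <= r * dot (mom_l x) (mom_l x) by rewrite mulr_ge0 ?dot_ge0// ltW.
have p2 : 0 <= r * dot (mom_r x) (mom_r x) by rewrite mulr_ge0 ?dot_ge0// ltW.
have p3 : 0 <= k * dot (cur_l x) (cur_l x) by rewrite mulr_ge0 ?dot_ge0// ltW.
have p4 : 0 <= k * dot (cur_r x) (cur_r x) by rewrite mulr_ge0 ?dot_ge0// ltW.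
have p5 : 0 <= m * vel x ^+ 2 by rewrite mulr_ge0 ?sqr_ge0// ltW.
have p6 : 0 <= I_m * rot x ^+ 2 by rewrite mulr_ge0 ?sqr_ge0// ltW.
by rewrite /inner -!expr2; split; [lra|lra|lra|lra|split; lra].
Qed.

Let part_bounded s (f : X -> R) : 0 < s -> (forall x, s * f x <= inner x x) ->
  exists2 K, 0 <= K & forall x, f x <= K * nrm x ^+ 2.
Proof.
move=> s0 fs; exists s^-1; first by rewrite invr_ge0 ltW.
by move=> x; rewrite X_norm_sqr -ler_pdivrMl ?invr_gt0// invrK.
Qed.

Let mom_l_bounded : vec_bounded (fun x => mom_l x).
Proof. by apply: (part_bounded r_gt0) => x; have [] := inner_parts x. Qed.
Let mom_r_bounded : vec_bounded (fun x => mom_r x).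
Proof. by apply: (part_bounded r_gt0) => x; have [] := inner_parts x. Qed.
Let cur_l_bounded : vec_bounded (fun x => cur_l x).
Proof. by apply: (part_bounded k_gt0) => x; have [] := inner_parts x. Qed.
Let cur_r_bounded : vec_bounded (fun x => cur_r x).
Proof. by apply: (part_bounded k_gt0) => x; have [] := inner_parts x. Qed.
Let vel_bounded : lin_bounded (fun x => vel x).
Proof. by apply: (part_bounded m_gt0) => x; have [_ _ _ _ []] := inner_parts x. Qed.
Let rot_bounded : lin_bounded (fun x => rot x).
Proof. by apply: (part_bounded I_m_gt0) => x; have [_ _ _ _ []] := inner_parts x. Qed.

Definition beam_momentum (x : X) : R := dot one_l (mom_l x) + dot one_r (mom_r x).
Definition beam_spin (x : X) : R := dot id_l (mom_l x) + dot id_r (mom_r x).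
Definition linear_momentum (x : X) : R := m * vel x + beam_momentum x.
Definition angular_momentum (x : X) : R := I_m * rot x + beam_spin x.
Definition mean_deflection (x : X) : R :=
  dot one_l (J2 (cur_l x)) + dot one_r (J2 (cur_r x)).
Definition deflection_moment (x : X) : R :=
  dot id_l (J2 (cur_l x)) + dot id_r (J2 (cur_r x)).
Definition virial (x y : X) : R :=
  dot (mom_l x) (J2 (cur_l y)) + dot (mom_r x) (J2 (cur_r y)).

Definition cross (x y : X) : R :=
  virial x y + (linear_momentum x * mean_deflection y + angular_momentum x * deflection_moment y).

Definition lyapunov N (x y : X) : R := N * inner x y + cross x y.

Let J2l_bounded := vec_bounded_antideriv2 N10 N10D0 cur_l_bounded.
Let J2r_bounded := vec_bounded_antideriv2 P01 P01D0 cur_r_bounded.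

Lemma cross_bounded : bil_bounded cross.
Proof.
apply: bil_boundedD; first by apply: bil_boundedD; apply: bil_bounded_dot.
by apply: bil_boundedD; apply: bil_boundedM;
  repeat first [exact: lin_bounded_dot | apply: lin_boundedD | exact: lin_boundedZ].
Qed.

Let lin_sum (h u u' v v' : R) :
  (u + h * u') + (v + h * v') = (u + v) + h * (u' + v').
Proof. ring. Qed.

Let virialDl h x y z : virial (x + h *: y) z = virial x z + h * virial y z.
Proof. by rewrite /virial /= !dot_linl lin_sum. Qed.

Let lin_affine (c h u u' w w' : R) :
  c * (u + h * u') + (w + h * w') = (c * u + w) + h * (c * u' + w').
Proof. ring. Qed.

Let linear_momentum_lin h x y :
  linear_momentum (x + h *: y) = linear_momentum x + h * linear_momentum y.
Proof. by rewrite /linear_momentum /beam_momentum /= !mxE !dot_linr lin_sum lin_affine. Qed.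

Let angular_momentum_lin h x y :
  angular_momentum (x + h *: y) = angular_momentum x + h * angular_momentum y.
Proof. by rewrite /angular_momentum /beam_spin /= !mxE !dot_linr lin_sum lin_affine. Qed.

Lemma crossDl h x y z : cross (x + h *: y) z = cross x z + h * cross y z.
Proof.
rewrite /cross virialDl linear_momentum_lin angular_momentum_lin.
move: (virial _ _) (virial _ _) (linear_momentum _) (linear_momentum _)
  (angular_momentum _) (angular_momentum _) (mean_deflection _) (deflection_moment _) => *.
ring.
Qed.

Let J2l_lin (f g : L2 (-1 : R) 0) h : J2 (f + h *: g) = J2 f + h *: J2 g.
Proof. exact: (L2_antideriv2_lin N10 N10D0). Qed.
Let J2r_lin (f g : L2 (0 : R) 1) h : J2 (f + h *: g) = J2 f + h *: J2 g.
Proof. exact: (L2_antideriv2_lin P01 P01D0). Qed.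

Let virialDr h x y z : virial z (x + h *: y) = virial z x + h * virial z y.
Proof. by rewrite /virial /= J2l_lin J2r_lin !dot_linr lin_sum. Qed.

Let mean_deflection_lin h x y :
  mean_deflection (x + h *: y) = mean_deflection x + h * mean_deflection y.
Proof. by rewrite /mean_deflection /= J2l_lin J2r_lin !dot_linr lin_sum. Qed.

Let deflection_moment_lin h x y :
  deflection_moment (x + h *: y) = deflection_moment x + h * deflection_moment y.
Proof. by rewrite /deflection_moment /= J2l_lin J2r_lin !dot_linr lin_sum. Qed.

Lemma crossDr h x y z : cross z (x + h *: y) = cross z x + h * cross z y.
Proof.
rewrite /cross virialDr mean_deflection_lin deflection_moment_lin.
move: (virial _ _) (virial _ _) (linear_momentum _) (angular_momentum _)
  (mean_deflection _) (mean_deflection _) (deflection_moment _) (deflection_moment _) => *.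
ring.
Qed.

Lemma lyapunovDl N h x y z :
  lyapunov N (x + h *: y) z = lyapunov N x z + h * lyapunov N y z.
Proof. by rewrite /lyapunov innerDl crossDl lin_affine. Qed.

Lemma lyapunovDr N h x y z :
  lyapunov N z (x + h *: y) = lyapunov N z x + h * lyapunov N z y.
Proof. by rewrite /lyapunov innerDr crossDr lin_affine. Qed.

Lemma inner_cauchy_schwarz x y : inner x y ^+ 2 <= nrm x ^+ 2 * nrm y ^+ 2.
Proof.
rewrite !X_norm_sqr.
by apply: form_cauchy_schwarz; [exact: innerC|move=> *; exact: innerDl|exact: inner_ge0].
Qed.

Lemma lyapunov_bounded N : exists2 C, 0 < C &
  forall x y, `|lyapunov N x y| <= C * nrm x * nrm y.
Proof.
have N2 : 0 <= N ^+ 2 by exact: sqr_ge0.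
have [K K0 BK] : bil_bounded (lyapunov N).
  apply: bil_boundedD; last exact: cross_bounded.
  exists (N ^+ 2) => // x y; rewrite exprMn -[leRHS]mulrA ler_wpM2l//.
  exact: inner_cauchy_schwarz.
exists (1 + K); first by rewrite ltr_pwDl.
by move=> x y; apply: sqr_le_norm; rewrite ?X_norm_ge0.
Qed.

Lemma lyapunov_coercive : exists N0, forall N x, N0 <= N -> nrm x ^+ 2 <= lyapunov N x x.
Proof.
have [K K0 BK] := cross_bounded; exists (2 + K) => N x KN.
have := sqr_le_norm K0 (X_norm_ge0 x) (X_norm_ge0 x) (BK x x).
rewrite -mulrA -expr2 X_norm_sqr /lyapunov => /ler_normlP[cx _].
have : (2 + K) * inner x x <= N * inner x x by rewrite ler_wpM2r// inner_ge0.
lra.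
Qed.

(** Averaging the two traces in the coupling condition is harmless, because they
    agree. *)
Lemma satellite_domP (x : X) : dom x ->
  [/\ Dl x.1.1, Dr x.1.2,
      vel x = r * H2_val (mom_l x) 0 /\ vel x = r * H2_val (mom_r x) 0 &
      rot x = r * H2_deriv (mom_l x) 0 /\ rot x = r * H2_deriv (mom_r x) 0].
Proof.
move=> [[dl dr B] C]; split => //.
  have B0 := congr1 (fun M : 'cV[R]_2 => M 0 0) B.
  have C0 := congr1 (fun M : 'cV[R]_2 => M 0 0) C.
  by move: B0 C0; rewrite /Bb /Cc mul1mx !mxE/= -/r => <- <-; split; lra.
have B0 := congr1 (fun M : 'cV[R]_2 => M 1 0) B.
have C0 := congr1 (fun M : 'cV[R]_2 => M 1 0) C.
by move: B0 C0; rewrite /Bb /Cc mul1mx !mxE/= -/r => <- <-; split; lra.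
Qed.

Lemma vel_op (x : X) : m * vel (op x) = k * H2_deriv (cur_l x) 0 - k * H2_deriv (cur_r x) 0.
Proof.
rewrite /satellite_op /= /Bc /Cb mul_diag_mx !mxE/=.
by rewrite -/k; field; rewrite gt_eqF.
Qed.

Lemma rot_op (x : X) : I_m * rot (op x) = k * H2_val (cur_r x) 0 - k * H2_val (cur_l x) 0.
Proof.
rewrite /satellite_op /= /Bc /Cb mul_diag_mx !mxE/=.
by rewrite -/k; field; rewrite gt_eqF.
Qed.

Lemma dot_mom_op p q (h f f2 : L2 p q) :
  dot h (- (gamma * r) *: f - k *: f2) = - (gamma * r) * dot h f - k * dot h f2.
Proof. by rewrite dotDr dotNr !dotZr. Qed.

Let dissipation_identity (g A1 A2 d12 d21 e12 e21 u u1 v v1 w w1 z z1 c1 c2 : R) :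
  d12 - d21 = u * v1 - v * u1 -> e12 - e21 = - (w * z1 - z * w1) ->
  c1 = r * u -> c1 = r * w -> c2 = r * u1 -> c2 = r * w1 ->
  r * ((- (g * r) * A1 - k * d12) + (- (g * r) * A2 - k * e12)) +
  k * (r * d21 + r * e21) + c1 * (k * v1 - k * z1) + c2 * (k * z - k * v) =
  - g * r ^+ 2 * (A1 + A2).
Proof.
move=> /eqP; rewrite subr_eq => /eqP -> /eqP; rewrite subr_eq => /eqP -> cu cw cu1 cw1.
have -> : c1 * (k * v1 - k * z1) = k * (r * u) * v1 - k * (r * w) * z1.
  by rewrite -cu -cw; ring.
have -> : c2 * (k * z - k * v) = k * (r * w1) * z - k * (r * u1) * v.
  by rewrite -cu1 -cw1; ring.
ring.
Qed.

Section on_domain.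
Variable x : X.
Hypothesis xD : dom x.

(** Green's formula on each beam leaves the work of the bending force and moment
    at [0], which is exactly what the body receives. *)
Lemma dissipation :
  inner x (op x) = - gamma * r ^+ 2 * (dot (mom_l x) (mom_l x) + dot (mom_r x) (mom_r x)).
Proof.
have [[h1 h2 v0 v10] [h3 h4 w0 w10] [vl vr] [ol or_]] := satellite_domP xD.
have := green N10 (H2_getP h1) (H2_getP h2); rewrite v0 v10 mulr0 mul0r subrr subr0 => gl.
have := green P01 (H2_getP h3) (H2_getP h4); rewrite w0 w10 mulr0 mul0r subrr sub0r => gr.
rewrite /inner -/r -/k [m * _]mulrCA [I_m * _]mulrCA vel_op rot_op.
rewrite /= !dot_mom_op !dotZr; exact: dissipation_identity gl gr vl vr ol or_.
Qed.

Let hl : H2 (mom_l x). Proof. by have [[]] := satellite_domP xD. Qed.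
Let hr : H2 (mom_r x). Proof. by have [_ []] := satellite_domP xD. Qed.

Let antideriv_op_l (h : L2 (-1 : R) 0) : dot h (J2 (cur_l (op x))) =
  r * dot h (mom_l x) - vel x * dot h one_l - rot x * dot h id_l.
Proof.
have [_ _ [vl _] [ol _]] := satellite_domP xD.
have -> : J2 (cur_l (op x)) = r *: J2 (H2_deriv2 (mom_l x)).
  have := L2_antideriv2_lin N10 N10D0 0 (H2_deriv2 (mom_l x)) r.
  have J0 : J2 (0 : L2 (-1 : R) 0) = 0.
    have := L2_antideriv2_lin N10 N10D0 0 0 (-1).
    by rewrite !scaleN1r subrr subrr.
  by rewrite J0 !add0r.
by rewrite dotZr dot_antideriv2_deriv2// vl ol; ring.
Qed.

Let antideriv_op_r (h : L2 (0 : R) 1) : dot h (J2 (cur_r (op x))) =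
  r * dot h (mom_r x) - vel x * dot h one_r - rot x * dot h id_r.
Proof.
have [_ _ [_ vr] [_ or_]] := satellite_domP xD.
have -> : J2 (cur_r (op x)) = r *: J2 (H2_deriv2 (mom_r x)).
  have := L2_antideriv2_lin P01 P01D0 0 (H2_deriv2 (mom_r x)) r.
  have J0 : J2 (0 : L2 (0 : R) 1) = 0.
    have := L2_antideriv2_lin P01 P01D0 0 0 (-1).
    by rewrite !scaleN1r subrr subrr.
  by rewrite J0 !add0r.
by rewrite dotZr dot_antideriv2_deriv2// vr or_; ring.
Qed.

Let virial_identity (A1 A2 c1 c2 p1 p2 q1 q2 : R) :
  (r * A1 - c1 * p1 - c2 * q1) + (r * A2 - c1 * p2 - c2 * q2) =
  r * (A1 + A2) - c1 * (p1 + p2) - c2 * (q1 + q2).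
Proof. ring. Qed.

Lemma virial_opr : virial x (op x) =
  r * (dot (mom_l x) (mom_l x) + dot (mom_r x) (mom_r x))
  - vel x * beam_momentum x - rot x * beam_spin x.
Proof.
rewrite /virial antideriv_op_l antideriv_op_r virial_identity /beam_momentum /beam_spin.
by rewrite !(dotC one_l) !(dotC one_r) !(dotC id_l) !(dotC id_r).
Qed.

Let virial_identity' (g G1 G2 B1 B2 : R) :
  (- (g * r) * G1 - k * B1) + (- (g * r) * G2 - k * B2) =
  - g * r * (G1 + G2) - k * (B1 + B2).
Proof. ring. Qed.

(** The momentum is driven by the second derivative of the bending moment, which
    two integrations by parts move onto the deflection. *)
Lemma virial_opl : virial (op x) x =
  - gamma * r * virial x x
  - k * (dot (cur_l x) (cur_l x) + dot (cur_r x) (cur_r x)).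
Proof.
have [[_ h2 v0 v10] [_ h4 w0 w10] _ _] := satellite_domP xD.
rewrite /virial (dotC (mom_l (op x))) (dotC (mom_r (op x))) /= !dot_mom_op.
rewrite (dotC (J2 (cur_l x)) (H2_deriv2 _)) (dotC (J2 (cur_r x)) (H2_deriv2 _)).
rewrite (dot_deriv2_antideriv2 N10 h2 (or_introl (conj erefl erefl)) v0 v10).
rewrite (dot_deriv2_antideriv2 P01 h4 (or_intror (conj erefl erefl)) w0 w10).
by rewrite virial_identity' (dotC (mom_l x)) (dotC (mom_r x)).
Qed.

Let momentum_identity (g p1 p2 v1 w1 : R) :
  (k * v1 - k * w1) + ((- (g * r) * p1 - k * v1) + (- (g * r) * p2 - k * - w1)) =
  - g * r * (p1 + p2).
Proof. ring. Qed.

(** The forces between the beams and the body are internal. *)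
Lemma linear_momentum_op : linear_momentum (op x) = - gamma * r * beam_momentum x.
Proof.
have [[_ h2 v0 v10] [_ h4 w0 w10] _ _] := satellite_domP xD.
rewrite /linear_momentum /beam_momentum vel_op /= !dot_mom_op !dot_one_deriv2// v10 w10 subr0 sub0r.
exact: momentum_identity.
Qed.

Let spin_identity (g p1 p2 v w : R) :
  (k * w - k * v) + ((- (g * r) * p1 - k * - v) + (- (g * r) * p2 - k * w)) =
  - g * r * (p1 + p2).
Proof. ring. Qed.

(** The torques between the beams and the body are internal. *)
Lemma angular_momentum_op : angular_momentum (op x) = - gamma * r * beam_spin x.
Proof.
have [[_ h2 v0 v10] [_ h4 w0 w10] _ _] := satellite_domP xD.
rewrite /angular_momentum /beam_spin rot_op /= !dot_mom_op !dot_id_deriv2// v0 v10 w0 w10.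
rewrite !mulr0 !mul0r !subr0 !sub0r !opprK.
exact: spin_identity.
Qed.

(** The coefficient [2] is the total length of the beams; there is no term in the
    angular velocity since [int xi] vanishes over [[-1, 1]]. *)
Lemma mean_deflection_op : mean_deflection (op x) = r * beam_momentum x - 2 * vel x.
Proof.
rewrite /mean_deflection antideriv_op_l antideriv_op_r virial_identity !dot_one_one// !dot_one_id//.
by rewrite /beam_momentum; field.
Qed.

(** Here [2 / 3] is the integral of [xi ^ 2] over [[-1, 1]]. *)
Lemma deflection_moment_op : deflection_moment (op x) = r * beam_spin x - 2 / 3 * rot x.
Proof.
rewrite /deflection_moment antideriv_op_l antideriv_op_r virial_identity !dot_id_id//.
rewrite !(dotC (L2_id _ _) (L2_one _ _)) !dot_one_id//.
by rewrite /beam_spin; field.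
Qed.

End on_domain.

Let sum_sqr (s t u v : R) : s ^+ 2 <= u -> t ^+ 2 <= v -> (s + t) ^+ 2 <= 2 * (u + v).
Proof. by have := sqr_ge0 (s - t); rewrite !expr2; lra. Qed.

Let J2l_le (f : L2 (-1 : R) 0) : dot (J2 f) (J2 f) <= 16 * dot f f.
Proof.
apply: (le_trans (L2_antideriv2_bounded N10 N10D0 f)).
by rewrite le_eqVlt; apply/orP; left; apply/eqP; congr (_ * _); ring.
Qed.

Let J2r_le (f : L2 (0 : R) 1) : dot (J2 f) (J2 f) <= 16 * dot f f.
Proof.
apply: (le_trans (L2_antideriv2_bounded P01 P01D0 f)).
by rewrite le_eqVlt; apply/orP; left; apply/eqP; congr (_ * _); ring.
Qed.

Let norm_constants : [/\ dot one_l one_l <= 1, dot one_r one_r <= 1,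
  dot id_l id_l <= 1 & dot id_r id_r <= 1].
Proof. by rewrite !dot_one_one// !dot_id_id//; split; lra. Qed.

Let dot_small (p q : R) (h f : L2 p q) u : dot h h <= 1 -> dot f f <= u -> dot h f ^+ 2 <= u.
Proof.
move=> h1 fu; apply: (le_trans (cauchy_schwarz h f)).
by apply: le_trans fu; rewrite ler_piMl ?dot_ge0.
Qed.

Lemma lyapunov_decay : exists N0, forall N x, N0 <= N -> dom x ->
  lyapunov N x (op x) + lyapunov N (op x) x <=
  - 3^-1 * nrm x ^+ 2.
Proof.
have K32 : 0 < (32 : R) by [].
have [N0 N0P] := lyapunov_arithmetic r_gt0 k_gt0 m_gt0 I_m_gt0 gamma_gt0 K32.
exists N0 => N x NN xD.
have [nl nr i1 i2] := norm_constants.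
pose a2 := dot (mom_l x) (mom_l x) + dot (mom_r x) (mom_r x).
pose b2 := dot (cur_l x) (cur_l x) + dot (cur_r x) (cur_r x).
have a0 : 0 <= a2 by rewrite addr_ge0 ?dot_ge0.
have b0 : 0 <= b2 by rewrite addr_ge0 ?dot_ge0.
have hM0 : beam_momentum x ^+ 2 <= 32 * a2.
  by apply: (le_trans (sum_sqr (dot_small nl (lexx _)) (dot_small nr (lexx _)))); rewrite -/a2; lra.
have hM1 : beam_spin x ^+ 2 <= 32 * a2.
  by apply: (le_trans (sum_sqr (dot_small i1 (lexx _)) (dot_small i2 (lexx _)))); rewrite -/a2; lra.
have two16 : 2 * (16 * dot (cur_l x) (cur_l x) + 16 * dot (cur_r x) (cur_r x)) = 32 * b2.
  by rewrite /b2 -mulrDr mulrA -natrM.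
have hF0 : mean_deflection x ^+ 2 <= 32 * b2.
  rewrite -two16.
  exact: (sum_sqr (dot_small nl (J2l_le _)) (dot_small nr (J2r_le _))).
have hF1 : deflection_moment x ^+ 2 <= 32 * b2.
  rewrite -two16.
  exact: (sum_sqr (dot_small i1 (J2l_le _)) (dot_small i2 (J2r_le _))).
have hG : virial x x ^+ 2 <= 32 * a2 * b2.
  have cs (p q : R) (f g : L2 p q) u : dot f f <= a2 -> dot g g <= u -> dot f g ^+ 2 <= a2 * u.
    move=> fa gu; apply: (le_trans (cauchy_schwarz f g)).
    by apply: ler_pM => //; exact: dot_ge0.
  have al : dot (mom_l x) (mom_l x) <= a2 by rewrite lerDl dot_ge0.
  have ar : dot (mom_r x) (mom_r x) <= a2 by rewrite lerDr dot_ge0.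
  apply: (le_trans (sum_sqr (cs _ _ _ _ _ al (J2l_le (cur_l x)))
     (cs _ _ _ _ _ ar (J2r_le (cur_r x))))).
  by rewrite -mulrDr mulrCA two16 mulrCA mulrA.
have := N0P N a2 b2 (vel x) (rot x) _ _ _ _ _ NN a0 b0 hM0 hM1 hF0 hF1 hG.
have -> : r * a2 + k * b2 + m * vel x ^+ 2 + I_m * rot x ^+ 2 = nrm x ^+ 2.
  by rewrite X_norm_sqr /inner -/r -/k -!expr2.
apply: le_trans; rewrite le_eqVlt; apply/orP; left; apply/eqP.
rewrite /lyapunov /cross (innerC (op x)) dissipation// virial_opr// virial_opl//.
rewrite linear_momentum_op// angular_momentum_op//.
rewrite mean_deflection_op// deflection_moment_op// -/a2 -/b2.
rewrite /linear_momentum /angular_momentum.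
move: (beam_momentum x) (beam_spin x) (virial x x) (mean_deflection x) (deflection_moment x)
  (vel x) (rot x) a2 b2 {a0 b0 hM0 hM1 two16 hF0 hF1 hG} => *.
ring.
Qed.

(** The velocity of the body prescribes the value and the slope of the momenta at
    [0], while the curvatures have to vanish to first order at the free ends. *)
Lemma satellite_dom_dense x e : 0 < e ->
  exists y, dom y /\ nrm (x - y) < e.
Proof.
move=> e0; pose eta := e ^+ 2 / (2 * (r + k)).
have rk0 : 0 < 2 * (r + k) by rewrite mulr_gt0// addr_gt0.
have eta0 : 0 < eta by rewrite divr_gt0// exprn_gt0.
set c1 := x.2 0 0; set c2 := x.2 1 0.
have [gl [Hl l0 l1 dl]] := L2_approximation_with_jet N10 (rho * a * c1) (rho * a * c2)
  x.1.1.1 (or_intror (erefl 0)) eta0.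
have [gr [Hr r0' r1 dr]] := L2_approximation_with_jet P01 (rho * a * c1) (rho * a * c2)
  x.1.2.1 (or_introl (erefl 0)) eta0.
have [hl [Gl l0' l1' dl']] := L2_approximation_with_jet N10 0 0
  x.1.1.2 (or_introl (erefl (-1))) eta0.
have [hr [Gr s0 s1 dr']] := L2_approximation_with_jet P01 0 0
  x.1.2.2 (or_intror (erefl 1)) eta0.
exists (((gl, hl), (gr, hr)), x.2); split.
  have ra : (rho * a)^-1 * (rho * a) = 1 by rewrite mulVf// gt_eqF// mulr_gt0.
  have jet : (rho * a)^-1 *: col2 (rho * a * c1) (rho * a * c2) = x.2.
    apply/colP => i; rewrite !mxE; case: ifPn => [/eqP->|iN0].
      by rewrite mulrA ra mul1r.
    have -> : i = 1 by apply/val_inj; case: i iN0 => -[|[|]].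
    by rewrite mulrA ra mul1r.
  split => /=.
    by split => //=; rewrite /Bl /Br/= l0 l1 r0' r1.
  have half : 2^-1 + 2^-1 = 1 :> R by field.
  by rewrite /Bb /Bl /Br /Cc /= l0 l1 r0' r1 jet mul1mx -scalerDl half scale1r.
rewrite -(@ltr_pXn2r _ 2)// ?nnegrE ?X_norm_ge0 ?(ltW e0)//.
rewrite X_norm_sqr /inner /= !mxE !subrr !mulr0 !addr0 -/r -/k.
apply: (@lt_le_trans _ _ (r * (eta + eta) + k * (eta + eta))).
  by apply: ltrD; rewrite ltr_pM2l// ltrD.
rewrite (_ : _ + _ = 2 * (r + k) * eta); last by ring.
by rewrite /eta mulrC divfK// gt_eqF.
Qed.

End satellite.

(** * Exponential stability *)

Theorem theorem3p1 (R : realType) (rho a E I gamma m I_m : R)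
  (rho_gt0 : 0 < rho) (a_gt0 : 0 < a) (E_gt0 : 0 < E) (I_gt0 : 0 < I)
  (gamma_gt0 : 0 < gamma) (m_gt0 : 0 < m) (I_m_gt0 : 0 < I_m)
  (T : R -> X R -> X R)
  (T_C0 : C0_semigroup (X_norm rho a E I m I_m) T)
  (T_contractive : contractive (X_norm rho a E I m I_m) T)
  (T_gen : generates (X_norm rho a E I m I_m) (satellite_dom rho a)
             (satellite_op rho a E I gamma m I_m) T) :
  exponentially_stable (X_norm rho a E I m I_m) T.
Proof.
have [N0 decay] := lyapunov_decay rho_gt0 a_gt0 E_gt0 I_gt0 gamma_gt0 m_gt0 I_m_gt0.
have [N1 coercive] := lyapunov_coercive rho_gt0 a_gt0 E_gt0 I_gt0 m_gt0 I_m_gt0.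
pose N := Num.max N0 N1.
have NN0 : N0 <= N by rewrite le_max lexx.
have NN1 : N1 <= N by rewrite le_max lexx orbT.
have [C C0 bounded] := lyapunov_bounded rho_gt0 a_gt0 E_gt0 I_gt0 m_gt0 I_m_gt0 N.
have k0 : 0 < (3^-1 : R) by rewrite invr_gt0.
apply: (@lyapunov_exponential_stability R (X R) (X_norm rho a E I m I_m) _ _ _
  T (satellite_dom rho a) (satellite_op rho a E I gamma m I_m) T_C0 T_contractive T_gen
  _ (lyapunov rho a E I m I_m N) C 1 3^-1) => //.
- by move=> x; exact: X_norm_ge0.
- by move=> c x; exact: X_normZ.
- by move=> x y; exact: X_normD.
- by move=> x e; exact: satellite_dom_dense.
- by move=> *; exact: lyapunovDl.
- by move=> *; exact: lyapunovDr.
- by move=> x; rewrite mul1r; exact: coercive.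
- by move=> x; exact: decay.
Qed.
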